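(* Let $n\ge2$ and $1\le k\le n$, and let $M$ be a closed strictly $k$-convex hypersurface in $\mathbb{R}^{n+1}$, given by $X:M\to\mathbb{R}^{n+1}$, with second fundamental form $A$, principal curvatures $\lambda=(\lambda_1,\dots,\lambda_n)$ and inward-pointing unit normal $e_{n+1}$. Let $F(A)=f(\lambda)$ be a smooth function of the principal curvatures. Assume that either $F\ge\dfrac{(n-k+1)\sigma_{k-1}(\lambda)}{k\,\sigma_k(\lambda)}$ on $M$, or $F\le\dfrac{(n-k+1)\sigma_{k-1}(\lambda)}{k\,\sigma_k(\lambda)}$ on $M$. If $X$ is a solution of $$F(A(x))=-\langle X(x),e_{n+1}(x)\rangle\qquad\text{for all }x\in M,$$ then $F=\dfrac{(n-k+1)\sigma_{k-1}(\lambda)}{k\,\sigma_k(\lambda)}$ on $M$, and the solution must be a round sphere.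
   Context: A closed hypersurface in $\mathbb{R}^{n+1}$ here means a smooth embedding $X:M\to\mathbb{R}^{n+1}$ of a closed, orientable $n$-dimensional manifold $M$, and $\langle\cdot,\cdot\rangle$ is the standard Euclidean metric. The vector $e_{n+1}$ is the inward-pointing unit normal of $M$, $A=\{h_{ij}\}$ is the second fundamental form of $X$ (with the sign for which round spheres have positive principal curvatures), and the principal curvatures $\lambda_1,\dots,\lambda_n$ are the eigenvalues of $A$. For $\lambda\in\mathbb{R}^n$, $\sigma_m(\lambda)=\sum_{1\le i_1<\cdots<i_m\le n}\lambda_{i_1}\cdots\lambda_{i_m}$, with $\sigma_0=1$. $M$ is strictly $k$-convex if $\lambda(x)\in\Gamma_k=\{\mu\in\mathbb{R}^n:\sigma_1(\mu)>0,\dots,\sigma_k(\mu)>0\}$ for all $x\in M$.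
   Formalization: The closed manifold M is assumed connected (and nonempty); otherwise two concentric spheres centred at the origin, with F equal to the quotient and each normal pointing to the origin, satisfy all hypotheses without being a round sphere. *)

(* Defs.v *)
From HB Require Import structures.
From mathcomp Require Import all_boot all_order all_fingroup all_algebra.
From mathcomp Require Import all_classical all_reals all_analysis.

Set Implicit Arguments.
Unset Strict Implicit.
Unset Printing Implicit Defensive.

Import Order.TTheory GRing.Theory Num.Theory.
Import numFieldNormedType.Exports.

Local Open Scope classical_set_scope.
Local Open Scope ring_scope.

(* The library norm on 'rV[R]_n is the sup norm: it induces the right topology,
   but Euclidean geometry has to go through [dot]. *)
Definition dot {R : realType} {n : nat} (u v : 'rV[R]_n) : R :=
  \sum_(i < n) u 0 i * v 0 i.

Definition iter_derive {R : realType} {V W : normedModType R}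
    (vs : seq V) (f : V -> W) : V -> W :=
  foldr (fun v g => 'D_v g) f vs.

(* C^oo on an open set [U] of a finite-dimensional space: all iterated
   directional derivatives exist and are continuous at the points of [U]. *)
Definition smooth_on {R : realType} {V W : normedModType R}
    (U : set V) (f : V -> W) : Prop :=
  forall (vs : seq V) (x : V), U x ->
    {for x, continuous (iter_derive vs f)} /\
    forall v : V, derivable (iter_derive vs f) x v.

(* Only the restriction of [coord] to [dom] and of [param] to the image
   [coord @` dom] are meaningful. *)
Record chart (R : realType) (n : nat) (M : topologicalType) := Chart {
  dom : set M;
  coord : M -> 'rV[R]_n;
  param : 'rV[R]_n -> M }.

Section Manifold.
Context {R : realType} {n : nat} {M : topologicalType}.
Implicit Types (c d : chart R n M) (A B : set (chart R n M)).

Definition is_chart c : Prop :=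
  [/\ open (dom c), open (coord c @` dom c),
      (forall p, dom c p -> param c (coord c p) = p),
      (forall p, dom c p -> {for p, continuous (coord c)}) &
      (forall p, dom c p -> {for coord c p, continuous (param c)})].

Definition transition c d : 'rV[R]_n -> 'rV[R]_n := coord d \o param c.

Definition smooth_atlas A : Prop :=
  [/\ (forall c, A c -> is_chart c),
      (forall p, exists2 c, A c & dom c p) &
      (forall c d, A c -> A d ->
         smooth_on (coord c @` (dom c `&` dom d)) (transition c d))].

Definition oriented_atlas B : Prop :=
  smooth_atlas B /\
  forall c d p, B c -> B d -> dom c p -> dom d p ->
    0 < \det ('J (transition c d) (coord c p)).

Definition orientable A : Prop :=
  exists2 B, oriented_atlas B & smooth_atlas (A `|` B).

Definition smooth_manifold A : Prop :=
  [/\ smooth_atlas A, hausdorff_space M & @second_countable M].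

(* Connectedness is part of the convention: a union of concentric spheres is
   not a round sphere. *)
Definition closed_manifold A : Prop :=
  [/\ smooth_manifold A, compact [set: M], connected [set: M] &
      [set: M] !=set0].

End Manifold.

Section Hypersurface.
Context {R : realType} {n : nat} {M : topologicalType}.
Implicit Types (A : set (chart R n M)) (c : chart R n M).
Implicit Types (X e : M -> 'rV[R]_n.+1) (p : M).

Definition local_param X c : 'rV[R]_n -> 'rV[R]_n.+1 := X \o param c.

Definition smooth_embedding A X : Prop :=
  [/\ (forall c, A c -> smooth_on (coord c @` dom c) (local_param X c)),
      (forall c p, A c -> dom c p -> row_free ('J (local_param X c) (coord c p))),
      injective X &
      (forall U : set M, open U <-> exists2 V, open V & U = X @^-1` V)].

Definition partial (i : 'I_n) (Y : 'rV[R]_n -> 'rV[R]_n.+1) :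
    'rV[R]_n -> 'rV[R]_n.+1 :=
  'D_(delta_mx 0 i) Y.

Definition inside X : set 'rV[R]_n.+1 :=
  [set y | ~ range X y /\
           bounded_set (connected_component (~` range X) y)].

Definition inward_unit_normal A X e : Prop :=
  forall p,
    [/\ dot (e p) (e p) = 1,
        (forall c i, A c -> dom c p ->
           dot (partial i (local_param X c) (coord c p)) (e p) = 0) &
        \forall t \near 0^'+, inside X (X p + t *: e p)].

Definition first_form X c p : 'M[R]_n :=
  \matrix_(i, j) dot (partial i (local_param X c) (coord c p))
                     (partial j (local_param X c) (coord c p)).

(* For a round sphere with [e] pointing inwards this is positive definite. *)
Definition second_form X e c p : 'M[R]_n :=
  \matrix_(i, j) dot (partial i (partial j (local_param X c)) (coord c p)) (e p).

(* [lam p] lists, in some order and with multiplicity, the eigenvalues of the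
   second fundamental form relative to the metric induced by [X]. *)
Definition principal_curvatures A X e (lam : M -> 'rV[R]_n) : Prop :=
  forall c p, A c -> dom c p ->
    char_poly (invmx (first_form X c p) *m second_form X e c p) =
    \prod_(i < n) ('X - (lam p 0 i)%:P).

Definition round_sphere (S : set 'rV[R]_n.+1) : Prop :=
  exists (y0 : 'rV[R]_n.+1) (r : R),
    0 < r /\ S = [set y | dot (y - y0) (y - y0) = r ^+ 2].

End Hypersurface.

Section SymmetricFunctions.
Context {R : realType} {n : nat}.
Implicit Type mu : 'rV[R]_n.

Definition sigma (m : nat) mu : R :=
  \sum_(I : {set 'I_n} | #|I| == m) \prod_(i in I) mu 0 i.

Definition Gamma (k : nat) : set 'rV[R]_n :=
  [set mu | forall m, (1 <= m <= k)%N -> 0 < sigma m mu].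

Definition sigma_quotient (k : nat) mu : R :=
  ((n%:R - k%:R + 1) * sigma k.-1 mu) / (k%:R * sigma k mu).

(* A smooth function [F] of the principal curvatures is a smooth symmetric [f]
   on some permutation-invariant open set [Omega], such as [Gamma k]. *)
Definition smooth_symmetric_on (Omega : set 'rV[R]_n) (f : 'rV[R]_n -> R) : Prop :=
  [/\ open Omega, smooth_on Omega f &
      forall (s : 'S_n) mu, Omega mu ->
        Omega (col_perm s mu) /\ f (col_perm s mu) = f mu].

End SymmetricFunctions.

(* Main.v *)
Require Import Defs.
From HB Require Import structures.
From mathcomp Require Import all_boot all_order all_fingroup all_algebra.
From mathcomp Require Import all_classical all_reals all_analysis.
From mathcomp Require Import ring lra.
From mathcomp Require Import complex.

Set Implicit Arguments.
Unset Strict Implicit.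
Unset Printing Implicit Defensive.

Import Order.TTheory GRing.Theory Num.Theory.
Import numFieldNormedType.Exports.
Import Defs.

Local Open Scope classical_set_scope.
Local Open Scope ring_scope.

(** The equation is a disguised statement about the function |X|^2 / 2. Write
    u = - <X, e> for the support function and tau_i for the derivative of
    sigma_k in the direction of the i-th principal curvature. The Gauss formula
    gives the Hessian g - u h for |X|^2 / 2, so the operator with weights tau_i
    in principal directions maps |X|^2 / 2 to
    (n - k + 1) sigma_{k-1} - k sigma_k u. On Gamma_k the weights are positive,
    and the one-sided assumption on F = u says precisely that this quantity has
    a constant sign. Hence |X|^2 / 2, or its opposite, is a subsolution of an
    elliptic equation without zeroth order term on a closed connected manifold,
    and must be constant; the hypersurface is then a sphere about the origin, on
    which u lambda_i = 1 for all i.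

    The strong maximum principle is carried out with barriers that are
    restrictions of ambient functions: at a critical point, their second
    derivatives along the hypersurface involve X only through the second
    fundamental form. Let sg = 1 or - 1 be such that sg |X|^2 / 2 is a
    subsolution, and let r be the value of |X| where this function is maximal.
    For a unit vector y, add the small barrier
    eps exp (al (<X, y> - rho)). At a maximum point of the sum
    ([critical_frame]), the first derivatives make sg X + kap y normal, and the
    second derivatives, weighted by tau_i, give
    al (1 - <y, e>^2) <= - k <y, e> sigma_1 ([weighted_barrier]); besides the
    signs of the terms, this uses sigma_k <= tau_i sigma_1
    ([sigma_le_zero_at]). The mean curvature sigma_1 is bounded on the compact
    hypersurface, so for al large and eps small, e is close to - y and X to r y
    ([sphere_approx]). By compactness the hypersurface contains the
    whole sphere of radius r ([sphere_in_range]).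

    It remains to see that the points on this sphere form an open set
    ([sphere_open]). A nearby point X q has its radial projection X c on the
    sphere, with c close to q because X is an embedding; the chord from X c to
    X q is radial, hence normal at c, and an immersion has no short normal
    chords ([normal_chord_trivial]). Connectedness concludes.

    Positivity of tau_i is classical: it follows by induction from Newton's
    inequality ([newton_ineq]), itself a consequence of the fact that
    derivatives of real-rooted polynomials are real-rooted
    ([split_poly_deriv]). *)

(** * Elementary symmetric functions on the cones Gamma_k *)

Definition split_poly (F : fieldType) (p : {poly F}) : Prop :=
  exists c (s : seq F), p = c *: \prod_(a <- s) ('X - a%:P).

Section Split.
Variable R : rcfType.

Lemma split_polyM (p q : {poly R}) :
  split_poly p -> split_poly q -> split_poly (p * q).
Proof.
move=> [c [s ->]] [d [t ->]]; exists (c * d), (s ++ t).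
by rewrite big_cat /= -scalerAl -scalerAr scalerA.
Qed.

Lemma split_poly_1DCX (a : R) : split_poly (1 + a *: 'X).
Proof.
have [->|a0] := eqVneq a 0.
  by exists 1, [::]; rewrite big_nil scale0r addr0 scale1r.
exists a, [:: - a^-1]; rewrite big_seq1 scalerBr addrC; congr (_ + _).
by rewrite polyCN scalerN opprK -mul_polyC -polyCM divff.
Qed.

(** The Gauss-Lucas argument: the imaginary part of the logarithmic derivative
    of a polynomial with real roots a is that of the sum of the 1 / (z - a), all
    of whose terms have the sign opposite to Im z. Multiplying by the squared
    modulus of P(z) avoids quotients. *)
Lemma Im_logderiv (z : complex R) (s : seq R) :
  complex.Im z != 0 ->
  let P := \prod_(a <- s) ('X - (real_complex R a)%:P) in
  P.[z] != 0 /\ exists N : R, [/\ 0 <= N, s != [::] -> 0 < N &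
    complex.Im (P^`().[z] * complex.conjc P.[z]) = - complex.Im z * N].
Proof.
move=> z0; elim: s => [|a s [P0 [N [N0 Npos NE]]]] /=.
  rewrite big_nil derivC horner0 mul0r hornerC; split; first exact: oner_neq0.
  by exists 0; split; rewrite ?mulr0.
rewrite !big_cons; move: P0 NE; set P := \prod_(j <- s) _ => P0 NE.
have za : z - real_complex R a != 0.
  rewrite subr_eq0; apply: contraNneq z0 => ->; by rewrite /= eqxx.
rewrite derivM derivXsubC mul1r !hornerE; split; first exact: mulf_neq0.
move: P0 NE za; case: P.[z] => x y; case: P^`().[z] => u v.
case: z z0 => z1 z2 /= z20 P0 NE _.
have P1 : 0 < x ^+ 2 + y ^+ 2.
  rewrite lt_neqAle addr_ge0 ?sqr_ge0 // andbT eq_sym.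
  rewrite paddr_eq0 ?sqr_ge0 // !sqrf_eq0; move: P0.
  by rewrite complex.eq_complex /=.
exists (x ^+ 2 + y ^+ 2 + ((z1 - a) ^+ 2 + z2 ^+ 2) * N); split.
- by rewrite addr_ge0 ?mulr_ge0 ?addr_ge0 ?sqr_ge0 // ltW.
- by move=> _; rewrite ltr_pwDl // mulr_ge0 ?addr_ge0 ?sqr_ge0.
- rewrite [RHS](_ : _ = - z2 * (x ^+ 2 + y ^+ 2) + ((z1 - a) ^+ 2 + z2 ^+ 2) * (- z2 * N));
    last by ring.
  rewrite -NE /=; ring.
Qed.

(** By [Im_logderiv] the derivative has no root off the real line, so its
    complex factorization has real factors only. *)
Lemma split_poly_deriv (p : {poly R}) : split_poly p -> split_poly p^`().
Proof.
move=> [c [s ->]]; rewrite derivZ.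
have z0 : split_poly (0 : {poly R}) by exists 0, [::]; rewrite scale0r.
have [->|c0] := eqVneq c 0; first by rewrite scale0r.
have [->|s0] := eqVneq s [::]; first by rewrite big_nil derivC scaler0.
set P := \prod_(a <- s) _.
have [->|P0] := eqVneq P^`() 0; first by rewrite scaler0.
pose iota := real_complex R.
have [r rE] := closed_field_poly_normal (map_poly iota P^`()).
have rR z : z \in r -> z = iota (complex.Re z).
  move=> zr; suff : complex.Im z = 0 by case: z {zr} => a b /= ->.
  apply/eqP; apply/negPn/negP => z2.
  have [_ [N [_ /(_ s0) N0]]] := Im_logderiv s z2.
  set Q := \prod_(a <- s) _.
  have QE : Q = map_poly iota P.
    by rewrite rmorph_prod; apply: eq_bigr => a _; rewrite /= map_polyXsubC.
  have -> : Q^`().[z] = 0.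
    apply/eqP; rewrite QE deriv_map rE hornerZ mulf_eq0; apply/orP; right.
    by rewrite -rootE root_prod_XsubC.
  rewrite mul0r /= => /eqP.
  by rewrite eq_sym mulf_eq0 (gt_eqF N0) orbF oppr_eq0 (negbTE z2).
have -> : P^`() = lead_coef P^`() *: \prod_(a <- map (@complex.Re R) r) ('X - a%:P).
  apply: (map_poly_inj iota); rewrite map_polyZ rE lead_coef_map rmorph_prod /=.
  congr (_ *: _); rewrite big_map; apply: eq_big_seq => z zr.
  by rewrite /= map_polyXsubC [z in LHS]rR.
by exists (c * lead_coef P^`()), (map (@complex.Re R) r); rewrite scalerA.
Qed.

(** For p with roots a, the expression is p^2 times the sum of the
    1 / (x - a)^2; the induction on the roots avoids dividing by p. *)
Lemma laguerre_ge0 (p : {poly R}) x : split_poly p ->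
  0 <= p^`().[x] ^+ 2 - p.[x] * p^`()^`().[x].
Proof.
move=> [c [s ->]]; rewrite !derivZ !hornerZ.
set q := \prod_(a <- s) _.
suff: 0 <= q^`().[x] ^+ 2 - q.[x] * q^`()^`().[x].
  by move=> H; rewrite (_ : _ - _ = c ^+ 2 * (q^`().[x] ^+ 2 - q.[x] * q^`()^`().[x]));
    [rewrite mulr_ge0 // sqr_ge0 | ring].
rewrite {}/q; elim: s => [|a s IH].
  by rewrite big_nil derivC deriv0 !hornerE subr0.
rewrite big_cons; move: IH; set r := \prod_(j <- s) _ => IH.
rewrite derivM derivXsubC mul1r derivD derivM derivXsubC mul1r.
rewrite !(hornerM, hornerXsubC, hornerD).
rewrite (_ : _ - _ = r.[x] ^+ 2 + (x - a) ^+ 2 * (r^`().[x] ^+ 2 - r.[x] * r^`()^`().[x]));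
  last by ring.
by rewrite addr_ge0 ?sqr_ge0 // mulr_ge0 ?sqr_ge0.
Qed.

End Split.

Lemma deriv_prod (R : comNzRingType) (I : finType) (F : I -> {poly R}) :
  (\prod_i F i)^`() = \sum_i (F i)^`() * \prod_(j | j != i) F j.
Proof.
elim: (index_enum I) (index_enum_uniq I) => [_|a s IH /= /andP[as_ us]].
  by rewrite !big_nil derivC.
rewrite !big_cons eqxx /= derivM IH // mulr_sumr; congr (_ * _ + _).
  rewrite big_seq_cond [RHS]big_seq_cond; apply: eq_bigl => j.
  by rewrite andbT; case: (boolP (j \in s)) => //= js; apply/esym; apply: contraNneq as_ => <-.
rewrite big_seq [RHS]big_seq; apply: eq_bigr => i is_.
rewrite big_cons ifT 1?mulrCA //; apply: contraNneq as_ => ->//.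
Qed.

Section Sigma.
Variables (R : realType) (n : nat).
Implicit Types (mu : 'rV[R]_n) (i : 'I_n) (k m : nat).

(** The generating polynomial of the sigma m mu; it is used instead of the
    product of the X + mu_i so that the coefficients are indexed by m. *)
Definition sigma_gen mu : {poly R} := \prod_(i < n) (1 + mu 0 i *: 'X).

Lemma sigma_genE mu m : sigma m mu = (sigma_gen mu)`_m.
Proof.
rewrite /sigma_gen /sigma.
under [in RHS]eq_bigr => i _ do rewrite addrC.
rewrite bigA_distr coef_sum big_mkcond /=; apply: eq_bigr => I _.
have -> : \prod_(i < n) (if i \in I then mu 0 i *: 'X else 1) =
   (\prod_(i in I) mu 0 i) *: 'X^#|I| :> {poly R}.
  rewrite -big_mkcond /= scaler_prod; congr (_ *: _).
  by rewrite big_const iter_mulr_1.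
by rewrite coefZ coefXn eq_sym; case: eqP => _; rewrite ?mulr1 ?mulr0.
Qed.

Lemma sigma0 mu : sigma 0 mu = 1.
Proof.
rewrite sigma_genE -horner_coef0 horner_prod big1 // => i _.
by rewrite hornerD hornerC hornerZ hornerX mulr0 addr0.
Qed.

Lemma split_sigma_gen mu : split_poly (sigma_gen mu).
Proof.
apply: (big_ind (@split_poly R)).
- by exists 1, [::]; rewrite big_nil scale1r.
- exact: split_polyM.
- by move=> i _; apply: split_poly_1DCX.
Qed.

(** The m-th derivative of [sigma_gen] is real-rooted, and the Laguerre
    inequality for it at 0 involves exactly three consecutive coefficients. *)
Lemma newton_ineq mu m : sigma m mu * sigma m.+2 mu <= sigma m.+1 mu ^+ 2.
Proof.
have sp : split_poly (sigma_gen mu)^`(m).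
  elim: m => [|m IH]; first exact: split_sigma_gen.
  by rewrite derivnS; exact: split_poly_deriv.
have := laguerre_ge0 0 sp; rewrite -!derivnS !horner_coef0 !coef_derivn.
rewrite !addn0 -!sigma_genE !ffactnn.
set a := sigma m mu; set b := sigma m.+1 mu; set c := sigma m.+2 mu.
rewrite -(mulr_natr a) -(mulr_natr b) -(mulr_natr c) !factS !natrM.
have f0 : 0 < (m`!)%:R :> R by rewrite ltr0n fact_gt0.
rewrite (_ : _ - _ = (m`!%:R) ^+ 2 * m.+1%:R * (m.+1%:R * b ^+ 2 - m.+2%:R * (a * c)));
  last by ring.
rewrite pmulr_rge0; last by rewrite mulr_gt0 ?exprn_gt0.
rewrite -(natr1 m.+1) => H.
have := ltr0Sn R m; set M := m.+1%:R in H *; move=> M0.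
have [|ac0] := leP (a * c) 0; first by move/le_trans; apply; exact: sqr_ge0.
rewrite -(ler_pM2l M0); lra.
Qed.

(** Deleting the i-th variable, without changing the dimension: symmetric
    functions do not see a zero entry. Thus sigma (k - 1) (zero_at i mu) is the
    derivative of sigma k with respect to mu_i. *)
Definition zero_at i mu : 'rV[R]_n := \row_j (if j == i then 0 else mu 0 j).

Lemma sigma_gen_zero_at i mu : sigma_gen (zero_at i mu) =
  \prod_(j < n | j != i) (1 + mu 0 j *: 'X).
Proof.
rewrite /sigma_gen (bigD1 i) //= !mxE eqxx scale0r addr0 mul1r.
by apply: eq_bigr => j ji; rewrite mxE (negbTE ji).
Qed.

Lemma sigmaS_zero_at i mu m :
  sigma m.+1 mu = sigma m.+1 (zero_at i mu) + mu 0 i * sigma m (zero_at i mu).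
Proof.
rewrite !sigma_genE {1}/sigma_gen (bigD1 i) //= -sigma_gen_zero_at.
by rewrite mulrDl mul1r -scalerAl coefD coefZ coefXM.
Qed.

(** Euler's identity for the homogeneous function sigma m.+1. *)
Lemma sum_mu_sigma mu m :
  \sum_i mu 0 i * sigma m (zero_at i mu) = m.+1%:R * sigma m.+1 mu.
Proof.
have -> : m.+1%:R * sigma m.+1 mu = (sigma_gen mu)^`()`_m.
  by rewrite sigma_genE coef_deriv mulr_natl.
have -> : (sigma_gen mu)^`() = \sum_i mu 0 i *: sigma_gen (zero_at i mu).
  rewrite deriv_prod; apply: eq_bigr => i _; rewrite sigma_gen_zero_at.
  by rewrite derivD derivC add0r derivZ derivX -scalerAl mul1r.
by rewrite coef_sum; apply: eq_bigr => i _; rewrite coefZ sigma_genE.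
Qed.

Lemma sum_sigma_zero_at mu m : (m < n)%N ->
  \sum_i sigma m (zero_at i mu) = (n - m)%:R * sigma m mu.
Proof.
case: m => [|m] mn.
  under eq_bigr => i _ do rewrite sigma0.
  by rewrite sumr_const card_ord subn0 sigma0 mulr1.
have E i : mu 0 i * sigma m (zero_at i mu) = sigma m.+1 mu - sigma m.+1 (zero_at i mu).
  by rewrite (sigmaS_zero_at i) [X in X - _]addrC addrK.
have := sum_mu_sigma mu m; rewrite (eq_bigr _ (fun i _ => E i)).
rewrite big_split /= sumr_const card_ord sumrN -[_ *+ n]mulr_natl => H.
rewrite natrB 1?ltnW // mulrBl -H.
by rewrite opprB addrC subrK.
Qed.

(** Ellipticity of sigma k on its cone. If a, b, c are consecutive symmetric
    functions of the other variables and t = mu_i, then b + t a and c + t b are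
    positive, a is positive by induction and a c <= b^2; were b <= 0, then
    a (c + t b) <= b (b + t a) <= 0. *)
Lemma Gamma_zero_at k mu i m : Gamma k mu -> (m < k)%N -> 0 < sigma m (zero_at i mu).
Proof.
move=> G; elim: m => [|m IH] mk; first by rewrite sigma0.
have {IH}a0 := IH (ltnW mk).
have s1 := G m.+1 (ltnW mk); have s2 := G m.+2 mk.
have N := newton_ineq (zero_at i mu) m.
rewrite (sigmaS_zero_at i mu m) in s1; rewrite (sigmaS_zero_at i mu m.+1) in s2.
rewrite ltNge; apply/negP => b0.
move: a0 s1 s2 N b0; set a := sigma m _; set b := sigma _ _; set c := sigma _ _.
set t := mu 0 i => a0 s1 s2 N b0.
have : 0 < a * (c + t * b) by rewrite mulr_gt0.
have : (b + t * a) * b <= 0 by rewrite mulr_ge0_le0 // ltW.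
nra.
Qed.

(** In the expansion of sigma k along mu_i it suffices to bound
    sigma k by sigma_(k-1) sigma_1 for the other variables, where Newton's
    inequality makes the successive quotients decrease. This comparison of the
    ellipticity constant with sigma k is what makes a bound of the mean
    curvature sufficient for the barrier argument. *)
Lemma sigma_le_zero_at k mu i : Gamma k.+1 mu ->
  sigma k.+1 mu <= sigma k (zero_at i mu) * sigma 1 mu.
Proof.
move=> G; rewrite (sigmaS_zero_at i _ k) (sigmaS_zero_at i _ 0) sigma0 mulr1.
have G' m := @Gamma_zero_at k.+1 mu i m G.
rewrite mulrDr [X in _ <= _ + X]mulrC lerD2r.
have : (k < k.+1)%N by []. move: {-2}k => m; elim: m => [|m IH] mk; first by rewrite sigma0 mul1r.
have a0 := G' m (ltnW mk); have b0 := G' m.+1 mk.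
have {IH} := IH (ltnW mk); have := newton_ineq (zero_at i mu) m.
set a := sigma m _ in a0 *; set b := sigma m.+1 _ in b0 *; set c := sigma _.+2 _.
set s := sigma 1 _ => N H.
rewrite -(ler_pM2l a0); apply: le_trans N _.
by rewrite expr2 mulrCA ler_pM2l.
Qed.
End Sigma.

Section SigmaRoots.
Variables (R : realType) (n : nat).
Implicit Types (mu : 'rV[R]_n).

Lemma sigma_roots mu (lam : 'rV[R]_n) m :
  \prod_i ('X - (mu 0 i)%:P) = \prod_i ('X - (lam 0 i)%:P) -> sigma m mu = sigma m lam.
Proof.
have E (l : 'rV[R]_n) : \prod_i ('X - (l 0 i)%:P) = \prod_(a <- [seq l 0 i | i : 'I_n]) ('X - a%:P).
  by rewrite big_image.
rewrite !E => /prod_XsubC_eq /= s.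
have G (l : 'rV[R]_n) : sigma_gen l = \prod_(a <- [seq l 0 i | i : 'I_n]) (1 + a *: 'X).
  by rewrite big_image.
by rewrite !sigma_genE !G (perm_big _ s).
Qed.

Lemma sigma_quotient_sigma k mu (lam : 'rV[R]_n) : (forall m, sigma m mu = sigma m lam) ->
  sigma_quotient k mu = sigma_quotient k lam.
Proof. by move=> E; rewrite /sigma_quotient !E. Qed.

End SigmaRoots.

(** * Simultaneous diagonalization of real quadratic forms *)

Section Spectral.
Variable R : rcfType.

Lemma row_sq_gt0 n (v : 'rV[R]_n) : v != 0 -> 0 < (v *m v^T) 0 0.
Proof.
move=> v0; rewrite mxE lt_neqAle sumr_ge0 => [|i _]; last by rewrite mxE -expr2 sqr_ge0.
rewrite andbT eq_sym; apply: contra v0; rewrite psumr_eq0 => [/allP w0|i _].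
  by apply/eqP/rowP => i; apply/eqP; have := w0 i (mem_index_enum _); rewrite !mxE mulf_eq0 orbb.
by rewrite mxE -expr2 sqr_ge0.
Qed.

(** A complex eigenvalue z with eigenvector v satisfies
    z <v, v> = <v H, v> = <v, v H> = conj z <v, v>. *)
Lemma sym_eigenvalue n (H : 'M[R]_n.+1) : H^T = H -> exists a, eigenvalue H a.
Proof.
move=> Hs; pose iota := real_complex R.
pose A := map_mx iota H.
have As : A^T = A by rewrite /A map_trmx Hs.
have [z zA] : exists z : complex R, root (char_poly A) z.
  by apply/closed_rootP; rewrite size_char_poly.
have [v vA v0] : exists2 v : 'rV[complex R]_n.+1, v *m A = z *: v & v != 0.
  by apply/eigenvalueP; rewrite eigenvalue_root_char.
pose w := map_mx (@complex.conjc R) v.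
have wA : w *m A = complex.conjc z *: w.
  have -> : A = map_mx (@complex.conjc R) A.
    by rewrite /A -map_mx_comp; apply/matrixP => i j; rewrite !mxE /= oppr0.
  by rewrite -map_mxM vA map_mxZ.
have E : z *: (v *m w^T) = complex.conjc z *: (v *m w^T).
  rewrite scalemxAl -vA -mulmxA (_ : A *m w^T = (w *m A)^T).
    by rewrite wA linearZ /= -scalemxAr.
  by rewrite trmx_mul As.
have vw0 : (v *m w^T) 0 0 != 0.
  apply: contraNneq v0; rewrite mxE => /eqP.
  rewrite psumr_eq0 => [/allP v0|i _]; last by rewrite !mxE; exact: complex.mulcJ_ge0.
  apply/eqP/rowP => i; have := v0 i (mem_index_enum _).
  by rewrite !mxE mulf_eq0 complex.conjc_eq0 orbb => /eqP.
have zz : z = complex.conjc z.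
  by apply: (mulIf vw0); move/matrixP/(_ 0 0): E; rewrite mxE [RHS]mxE.
exists (complex.Re z).
rewrite eigenvalue_root_char -(fmorph_root iota) map_char_poly.
suff zE : iota (complex.Re z) = z by move: zA; rewrite -{1}zE.
case: z zz {zA vA wA E} => a b [] /= /eqP; rewrite -subr_eq0 opprK -mulr2n mulrn_eq0 /=.
by move=> /eqP ->.
Qed.

(** The Householder reflection exchanging x and the first basis vector. *)
Lemma orthogonal_row0 n (x : 'rV[R]_n.+1) : x *m x^T = 1%:M ->
  exists2 Q : 'M[R]_n.+1, Q *m Q^T = 1%:M & row 0 Q = x.
Proof.
move=> x1; pose e0 : 'rV[R]_n.+1 := delta_mx 0 0.
have [<-|xe] := eqVneq e0 x.
  by exists 1%:M; [rewrite trmx1 mulmx1 | rewrite row1].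
pose w := x - e0; pose c := (w *m w^T) 0 0.
have e1 : e0 *m e0^T = 1%:M.
  by apply/matrixP => i j; rewrite trmx_delta mul_delta_mx !ord1 !mxE.
have ex : e0 *m x^T = (x 0 0)%:M.
  by rewrite -rowE [LHS]mx11_scalar !mxE.
have xe' : x *m e0^T = (x 0 0)%:M.
  by rewrite -[LHS]trmxK trmx_mul trmxK ex tr_scalar_mx.
have cE : c = 2 - 2 * x 0 0.
  rewrite /c /w linearB /= mulmxBl !mulmxBr x1 e1 ex xe' !mxE eqxx !mulr1n; ring.
have c0 : c != 0.
  by rewrite gt_eqF // row_sq_gt0 // subr_eq0 eq_sym.
have wwE : w *m w^T = c%:M by rewrite [LHS]mx11_scalar.
pose Q := 1%:M - (2 / c) *: (w^T *m w).
have QT : Q^T = Q.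
  by rewrite /Q linearB /= trmx1 linearZ /= trmx_mul trmxK.
exists Q.
  have TT : (w^T *m w) *m (w^T *m w) = c *: (w^T *m w).
    by rewrite mulmxA -(mulmxA w^T) wwE mul_mx_scalar -scalemxAl.
  rewrite QT /Q; move: (w^T *m w) TT => T TT.
  rewrite mulmxBl mul1mx mulmxBr mulmx1 -scalemxAl -scalemxAr TT !scalerA.
  rewrite (_ : 2 / c * (2 / c) * c = 2 / c + 2 / c); last by field.
  by rewrite scalerDl opprB addrK subrK.
rewrite rowE -/e0 /Q mulmxBr mulmx1 -scalemxAr mulmxA.
have -> : e0 *m w^T = (x 0 0 - 1)%:M by rewrite /w linearB /= mulmxBr ex e1 -raddfB.
rewrite mul_scalar_mx scalerA.
rewrite (_ : 2 / c * _ = -1); last by rewrite -[X in _ = - X](divff c0) cE; field; rewrite -cE.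
by rewrite scaleN1r opprK addrC subrK.
Qed.

(** Induction on the dimension: in an orthonormal basis that starts with an
    eigenvector, symmetry makes H block diagonal. *)
Theorem sym_orthogonal_diag n (H : 'M[R]_n) : H^T = H ->
  exists (Q : 'M[R]_n) (d : 'rV[R]_n), Q *m Q^T = 1%:M /\ Q *m H *m Q^T = diag_mx d.
Proof.
elim: n H => [|n IH] H Hs.
  by exists 1%:M, 0; split; apply/matrixP => -[].
have [a /eigenvalueP [v vH v0]] := sym_eigenvalue Hs.
pose q := (v *m v^T) 0 0.
have q0 : 0 < q by exact: row_sq_gt0.
pose x := (Num.sqrt q)^-1 *: v.
have s0 : Num.sqrt q != 0 by rewrite gt_eqF ?sqrtr_gt0.
have x1 : x *m x^T = 1%:M.
  rewrite /x linearZ /= -scalemxAr -scalemxAl scalerA [v *m _]mx11_scalar -/q.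
  rewrite scale_scalar_mx -invfM -expr2 sqr_sqrtr ?mulVf ?gt_eqF //; exact: ltW.
have xH : x *m H = a *: x by rewrite /x -scalemxAl vH !scalerA mulrC.
have [Q0 QQ Qx] := orthogonal_row0 x1.
have [B BE] : exists B : 'M[R]_(1 + n), B = Q0 *m H *m Q0^T by eexists.
have Bs : B^T = B by rewrite BE !trmx_mul trmxK Hs mulmxA.
have B0 j : B 0 j = a * (j == 0)%:R.
  suff /rowP/(_ j) : row 0 B = a *: delta_mx 0 0 by rewrite !mxE eqxx.
  by rewrite BE !row_mul Qx xH -scalemxAl -Qx -row_mul QQ row1.
have Bu : ulsubmx B = a%:M.
  apply/matrixP => i j; rewrite !ord1 !mxE eqxx mulr1n.
  by rewrite [lshift _ _](_ : _ = 0) ?B0 ?mulr1 //; apply/val_inj.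
have Bur : ursubmx B = 0.
  apply/matrixP => i j; rewrite !ord1 !mxE.
  by rewrite [lshift _ _](_ : _ = 0) ?B0 ?mulr0 //; apply/val_inj.
have Bdl : dlsubmx B = 0 by rewrite -Bs -trmx_ursub Bur trmx0.
have [|Q' [d [Q'Q Q'd]]] := IH (drsubmx B); first by rewrite trmx_drsub Bs.
have [P PP Pd] : exists2 P : 'M[R]_n.+1, P *m P^T = 1%:M &
    P *m B *m P^T = diag_mx (row_mx a%:M d : 'rV[R]_(1 + n)).
  pose P : 'M[R]_(1 + n) := block_mx 1%:M 0 0 Q'.
  have PT : P^T = block_mx 1%:M 0 0 Q'^T by rewrite /P tr_block_mx !trmx0 !trmx1.
  suff [P1 P2] : P *m P^T = 1%:M /\ P *m B *m P^T = diag_mx (row_mx a%:M d).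
    by exists P.
  rewrite PT /P; split.
    rewrite mulmx_block !mulmx0 !mul0mx !addr0 add0r mulmx1 Q'Q.
    by rewrite -scalar_mx_block.
  rewrite -[B]submxK Bu Bur Bdl !mulmx_block.
  rewrite !(mulmx0, mul0mx, mulmx1, mul1mx, addr0, add0r) Q'd diag_mx_row.
  by congr block_mx; apply/matrixP => i j; rewrite !ord1 !mxE.
exists (P *m Q0), (row_mx a%:M d : 'rV[R]_(1 + n)); split.
  by rewrite trmx_mul -mulmxA (mulmxA Q0) QQ mul1mx.
by rewrite trmx_mul -Pd BE !mulmxA.
Qed.

Definition pos_def n (g : 'M[R]_n) := forall v : 'rV[R]_n, v != 0 -> 0 < (v *m g *m v^T) 0 0.

(** Rescaling an orthogonal diagonalization of g gives a basis that is
    orthonormal for g, in which h is again symmetric; rotating this basis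
    diagonalizes h and does not affect g. *)
Theorem simultaneous_diag n (g h : 'M[R]_n) : g^T = g -> h^T = h -> pos_def g ->
  exists (V : 'M[R]_n) (mu : 'rV[R]_n), V *m g *m V^T = 1%:M /\ V *m h *m V^T = diag_mx mu.
Proof.
move=> gs hs gp.
have [Q [d [QQ Qd]]] := sym_orthogonal_diag gs.
have d0 i : 0 < d 0 i.
  have -> : d 0 i = (row i Q *m g *m (row i Q)^T) 0 0.
    have := congr1 (fun M : 'M[R]_n => M i i) Qd; rewrite mxE [in RHS]mxE eqxx mulr1n => <-.
    by rewrite -row_mul mxE; apply: eq_bigr => j _; rewrite !mxE.
  apply: gp; apply/eqP => Qi0.
  have := congr1 (fun M : 'M[R]_n => row i M) QQ.
  rewrite row_mul Qi0 mul0mx => /rowP/(_ i); rewrite !mxE eqxx => /eqP.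
  by rewrite eq_sym oner_eq0.
pose D : 'rV[R]_n := \row_i (Num.sqrt (d 0 i))^-1.
pose V0 := diag_mx D *m Q.
have V0g : V0 *m g *m V0^T = 1%:M.
  transitivity (diag_mx D *m (Q *m g *m Q^T) *m diag_mx D).
    by rewrite /V0 trmx_mul tr_diag_mx !mulmxA.
  apply/matrixP => i j; rewrite Qd mul_mx_diag mxE mul_diag_mx !mxE.
  have [->|_] := eqVneq i j; last by rewrite !mulr0n mulr0 mul0r.
  rewrite !mulr1n mulrAC -invfM -expr2 sqr_sqrtr; last exact: ltW.
  by rewrite mulVf // gt_eqF.
clearbody V0.
have [|Q' [mu [Q'Q Q'mu]]] := @sym_orthogonal_diag _ (V0 *m h *m V0^T).
  by rewrite !trmx_mul trmxK hs mulmxA.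
exists (Q' *m V0), mu; split.
  rewrite trmx_mul (_ : _ *m _ = Q' *m (V0 *m g *m V0^T) *m Q'^T); last by rewrite !mulmxA.
  by rewrite V0g mulmx1.
by rewrite trmx_mul -Q'mu !mulmxA.
Qed.

Lemma char_poly_simultaneous n (g h V : 'M[R]_n) (mu : 'rV[R]_n) :
  V *m g *m V^T = 1%:M -> V *m h *m V^T = diag_mx mu ->
  char_poly (invmx g *m h) = \prod_i ('X - (mu 0 i)%:P).
Proof.
move=> Vg Vh.
have Vu : V \in unitmx by case/mulmx1_unit: (etrans (mulmxA _ _ _) Vg).
have VTu : V^T \in unitmx by rewrite unitmx_tr.
have gV : g *m (V^T *m V) = 1%:M.
  apply: (can_inj (mulKmx Vu)); apply: (can_inj (mulmxK VTu)).
  by rewrite mulmx1 !mulmxA Vg mul1mx.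
have gi : invmx g = V^T *m V.
  have [gu _] := mulmx1_unit gV.
  by rewrite -[RHS](mulKmx gu) gV mulmx1.
have -> : invmx g *m h = V^T *m diag_mx mu *m invmx V^T.
  by rewrite gi -Vh !mulmxA mulmxK.
rewrite /char_poly.
have -> : char_poly_mx (V^T *m diag_mx mu *m invmx V^T) =
  map_mx polyC V^T *m char_poly_mx (diag_mx mu) *m map_mx polyC (invmx V^T).
  rewrite /char_poly_mx !map_mxM mulmxBr mulmxBl; congr (_ - _).
  by rewrite scalar_mxC -mulmxA -map_mxM mulmxV // map_mx1 mulmx1.
rewrite !det_mulmx mulrAC -det_mulmx -map_mxM mulmxV // map_mx1 det1 mul1r.
rewrite -/(char_poly _) char_poly_trig ?diag_mx_is_trig //.
by apply: eq_bigr => i _; rewrite mxE eqxx mulr1n.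
Qed.

End Spectral.

(** * Directional derivatives of continuously differentiable functions *)

Section Lines.
Variables (R : realType) (V W : normedModType R).
Implicit Types (f : V -> W) (x v : V).

Lemma is_derive_line f x v t : derivable f (x + t *: v) v ->
  is_derive t 1 (fun s : R => f (x + s *: v)) ('D_v f (x + t *: v)).
Proof.
move=> df; have E : (fun h : R => h^-1 *: (f (x + (h *: 1 + t) *: v) - f (x + t *: v))) =
   (fun h : R => h^-1 *: (f (h *: v + (x + t *: v)) - f (x + t *: v))).
  by apply/funext => h; rewrite [h *: 1]mulr1 scalerDl addrCA.
by apply: DeriveDef; rewrite /derivable /derive /= E.
Qed.

Lemma deriveZv f x v a : derivable f x v -> 'D_(a *: v) f x = a *: 'D_v f x.
Proof.
move=> df; have [->|a0] := eqVneq a 0; first by rewrite !scale0r derive0.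
rewrite {1}/derive; apply: cvg_lim => //; apply/cvgrPdist_le => e e0.
have na0 : 0 < `|a| by rewrite normr_gt0.
have /cvgrPdist_le /(_ (e / `|a|)) : (fun h => h^-1 *: ((f \o shift x) (h *: v) - f x)) @ 0^' --> 'D_v f x by exact: df.
rewrite divr_gt0 // => /(_ isT) [d /= d0 Hd].
near=> h.
have h0 : h != 0 by near: h; exact: nbhs_dnbhs_neq.
have hd : `|h| < d / `|a| by near: h; apply: dnbhs0_lt; exact: divr_gt0.
have := Hd (h * a); rewrite /ball_ /= sub0r normrN normrM -ltr_pdivlMr // mulf_neq0 //.
move=> /(_ hd isT); rewrite ler_pdivlMr // mulrC -normrZ scalerBr !scalerA invfM mulrCA divff // mulr1.
by [].
Unshelve. all: by end_near. Qed.

End Lines.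

Definition C1_on (R : realType) (V W : normedModType R) (U : set V) (f : V -> W) :=
  forall x, U x -> forall v, derivable f x v /\ {for x, continuous ('D_v f)}.

Section ScalarLines.
Variables (R : realType) (V : normedModType R).
Implicit Types (f : V -> R) (x v w : V).

Lemma derivable_MVT f x v :
  (forall t, 0 <= t <= 1 -> derivable f (x + t *: v) v) ->
  exists2 t, 0 < t < 1 & f (x + v) - f x = 'D_v f (x + t *: v).
Proof.
move=> df; have [||t t01] := @MVT R (fun s => f (x + s *: v)) (fun t => 'D_v f (x + t *: v)) 0 1 ltr01.
- move=> t; rewrite in_itv /= => /andP[t0 t1].
  by apply/is_derive_line/df; rewrite !ltW.
- apply: derivable_within_continuous => t; rewrite in_itv /= => t01.
  by have [] := is_derive_line (df t t01).
rewrite scale1r scale0r addr0 subr0 mulr1 => ->.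
by exists t => //; move: t01; rewrite in_itv.
Qed.

(** The increment of f along h (v + w) is split at x + h v; on the second part
    the mean value theorem gives a derivative in the direction w at a point that
    tends to x. *)
Lemma deriveDv (U : set V) f x v w : open U -> C1_on U f -> U x ->
  'D_(v + w) f x = 'D_v f x + 'D_w f x.
Proof.
move=> Uo fC Ux; rewrite /derive; apply: cvg_lim => //.
have E : (fun h : R => h^-1 *: ((f \o shift x) (h *: (v + w)) - f x)) =
  (fun h : R => h^-1 *: (f (h *: v + x) - f x)) \+
  (fun h : R => h^-1 *: (f (h *: v + x + h *: w) - f (h *: v + x))).
  apply/funext => h /=; rewrite -scalerDr [in RHS]addrC subrKA; congr (_ *: (f _ - _)).
  by rewrite scalerDr addrAC.
rewrite E; apply: cvgD; first by have [] := fC _ Ux v.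
have [_ /cvgrPdist_le wc] := fC _ Ux w.
apply/cvgrPdist_le => e e0.
have : \forall y \near x, U y /\ `|'D_w f x - 'D_w f y| <= e.
  near=> y; split; [near: y; exact: open_nbhs_nbhs | near: y; exact: wc].
move=> /nbhs_ballP [d /= d0 Hd].
pose c := `|v| + `|w| + 1.
have c0 : 0 < c by rewrite ltr_wpDl // addr_ge0.
near=> h.
have h0 : h != 0 by near: h; exact: nbhs_dnbhs_neq.
have hd : `|h| < d / c by near: h; apply: dnbhs0_lt; exact: divr_gt0.
have B t : 0 <= t <= 1 -> ball x d (h *: v + x + t *: (h *: w)).
  move=> /andP[t0 t1]; rewrite -ball_normE /ball_ /= distrC addrAC addrK.
  rewrite scalerA [t * h]mulrC -scalerA -scalerDr normrZ.
  rewrite (le_lt_trans (y := `|h| * c)) ?ler_wpM2l -?ltr_pdivlMr //.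
  rewrite (le_trans (ler_normD _ _)) // /c -addrA lerD2l normrZ ger0_norm //.
  by rewrite ler_wpDr // ler_piMl.
have [|t t01 ->] := @derivable_MVT f (h *: v + x) (h *: w).
  by move=> t /B /Hd [Ut _]; have [] := fC _ Ut (h *: w).
have [Ut le] : U (h *: v + x + t *: (h *: w)) /\
   `|'D_w f x - 'D_w f (h *: v + x + t *: (h *: w))| <= e.
  by apply/Hd/B; case/andP: t01 => *; rewrite !ltW.
rewrite deriveZv; last by have [] := fC _ Ut w.
by rewrite scalerA mulVf // scale1r.
Unshelve. all: by end_near. Qed.

(** Both mixed derivatives are values, at points close to x, of the second
    difference quotient of f, which is symmetric in v and w. *)
Lemma schwarz (U : set V) f x v w : open U -> C1_on U f ->
  C1_on U ('D_v f) -> C1_on U ('D_w f) -> U x ->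
  'D_v ('D_w f) x = 'D_w ('D_v f) x.
Proof.
move=> Uo fC fvC fwC Ux.
have [_ /cvgrPdist_le c1] := fvC _ Ux w.
have [_ /cvgrPdist_le c2] := fwC _ Ux v.
apply/eqP; rewrite -subr_eq0 -normr_le0; apply/ler_addgt0Pl => e e0.
rewrite addr0.
have e2 : 0 < e / 2 by rewrite divr_gt0.
have : \forall y \near x, U y /\ (`|'D_w ('D_v f) x - 'D_w ('D_v f) y| <= e / 2 /\
   `|'D_v ('D_w f) x - 'D_v ('D_w f) y| <= e / 2).
  exact: filterI (open_nbhs_nbhs (conj Uo Ux)) (filterI (c1 _ e2) (c2 _ e2)).
move=> /nbhs_ballP [d /= d0 Hd].
pose c := `|v| + `|w| + 1.
have c0 : 0 < c by rewrite ltr_wpDl // addr_ge0.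
have [h h0 hc] : exists2 h : R, 0 < h & h * c = d / 2.
  by exists (d / c / 2); [rewrite !divr_gt0 | field; exact: lt0r_neq0].
have h0' := ltW h0.
have B (s t : R) : 0 <= s <= 1 -> 0 <= t <= 1 -> ball x d (x + s *: (h *: v) + t *: (h *: w)).
  move=> /andP[s0 s1] /andP[t0 t1]; rewrite -ball_normE /ball_ /= distrC.
  rewrite addrAC [x + _]addrC addrK.
  rewrite (le_lt_trans (ler_normD _ _)) // !normrZ !ger0_norm //.
  rewrite (le_lt_trans (y := h * c)) //.
    by rewrite /c !mulrDr mulr1 ler_wpDr // lerD // ler_piMl // mulr_ge0.
  rewrite hc; lra.
have key a b : (forall s t : R, 0 <= s <= 1 -> 0 <= t <= 1 -> ball x d (x + s *: (h *: a) + t *: (h *: b))) ->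
    C1_on U ('D_a f) ->
    exists2 y, ball x d y & f (x + h *: a + h *: b) - f (x + h *: a) - (f (x + h *: b) - f x) =
      h * (h * 'D_b ('D_a f) y).
  move=> Bab faC.
  have D0 (t : R) : 0 <= t <= 1 -> derivable f (x + t *: (h *: a)) (h *: a).
    move=> t01; have := Bab t 0 t01; rewrite scale0r addr0 lexx ler01 => /(_ isT) /Hd [Ut _].
    by have [] := fC _ Ut (h *: a).
  have D1 (t : R) : 0 <= t <= 1 -> derivable f (x + h *: b + t *: (h *: a)) (h *: a).
    move=> t01; have := Bab t 1 t01; rewrite scale1r addrAC lexx ler01 => /(_ isT) /Hd [Ut _].
    by have [] := fC _ Ut (h *: a).
  pose g (s : R) := f (x + h *: b + s *: (h *: a)) - f (x + s *: (h *: a)).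
  pose dg (s : R) := 'D_(h *: a) f (x + h *: b + s *: (h *: a)) - 'D_(h *: a) f (x + s *: (h *: a)).
  have dgP (s : R) : 0 <= s <= 1 -> is_derive s 1 g (dg s).
    by move=> s01; apply: is_deriveB; apply: is_derive_line; [exact: D1|exact: D0].
  have [||s s01] := @MVT R g dg 0 1 ltr01.
  - by move=> t; rewrite in_itv /= => /andP[t0 t1]; apply: dgP; rewrite !ltW.
  - by apply: derivable_within_continuous => t; rewrite in_itv /= => /dgP[].
  have {}s01 : 0 <= s <= 1 by move: s01; rewrite in_itv /= => /andP[? ?]; rewrite !ltW.
  rewrite subr0 mulr1 /g !scale1r !scale0r !addr0 => gE.
  have [|t t01 tE] := @derivable_MVT ('D_a f) (x + s *: (h *: a)) (h *: b).
    by move=> t t01; have /Hd [Ut _] := Bab s t s01 t01; have [] := faC _ Ut (h *: b).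
  exists (x + s *: (h *: a) + t *: (h *: b)).
    by apply: Bab => //; case/andP: t01 => ? ?; rewrite !ltW.
  rewrite [x + h *: a + _]addrAC.
  rewrite gE /dg.
  have /Hd [U0 _] : ball x d (x + s *: (h *: a)).
    by have := Bab s 0 s01; rewrite scale0r addr0 lexx ler01; exact.
  have /Hd [U1 _] : ball x d (x + h *: b + s *: (h *: a)).
    by have := Bab s 1 s01; rewrite scale1r addrAC lexx ler01; exact.
  rewrite !deriveZv; [|by have [] := fC _ U0 a|by have [] := fC _ U1 a].
  rewrite -scalerBr addrAC tE.
  have /Hd [U2 _] : ball x d (x + s *: (h *: a) + t *: (h *: b)).
    by apply: Bab => //; case/andP: t01 => ? ?; rewrite !ltW.
  by rewrite deriveZv //; have [] := faC _ U2 b.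
have [y1 /Hd[_ [y1E _]] E1] := key v w B fvC.
have [|y2 /Hd[_ [_ y2E]] E2] := key w v _ fwC.
  by move=> s t s01 t01; rewrite addrAC; exact: B.
have : 'D_w ('D_v f) y1 = 'D_v ('D_w f) y2.
  apply: (mulfI (lt0r_neq0 h0)); apply: (mulfI (lt0r_neq0 h0)).
  apply: (etrans (esym E1)); apply: (etrans _ E2).
  rewrite (addrAC x (h *: w)); move: (f _) (f _) (f _) (f _) => A1 A2 A3 A4.
  ring.
move=> E; rewrite -(subrKA ('D_v ('D_w f) y2)) -{2}E.
apply: le_trans (ler_normD _ _) _; rewrite (splitr e); apply: lerD.
  exact: y2E.
by rewrite distrC; exact: y1E.
Qed.

End ScalarLines.

(* Conversion must not unfold iterated directional derivatives: comparing the
   underlying limits is very slow. *)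
#[local] Opaque derive.

Section VectorValued.
Variables (R : realType) (V : normedModType R) (m : nat).
Implicit Types (U : set V) (Y : V -> 'rV[R]_m) (x v w : V).

Lemma coord_le_norm k (u : 'rV[R]_k) i : `|u 0 i| <= `|u|.
Proof. by rewrite [leRHS]/Num.Def.normr/= mx_normrE; exact: (le_bigmax _ _ (ord0, i)). Qed.

Lemma norm_le_coord k (u : 'rV[R]_k) (a : R) :
  0 <= a -> (forall i, `|u 0 i| <= a) -> `|u| <= a.
Proof.
move=> a0 ua; rewrite [leLHS]/Num.Def.normr/= mx_normrE; apply: bigmax_le => // -[i j] _ /=.
by rewrite ord1.
Qed.

Lemma derivable_coord Y x v j : derivable Y x v -> derivable (fun y => Y y 0 j) x v.
Proof. by move/derivable_mxP; apply. Qed.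

Lemma derive_coord Y x v j : derivable Y x v -> 'D_v (fun y => Y y 0 j) x = 'D_v Y x 0 j.
Proof. by move=> d; rewrite derive_mx // mxE. Qed.

Lemma C1_coord U Y j : open U -> C1_on U Y -> C1_on U (fun y => Y y 0 j).
Proof.
move=> Uo YC x Ux v; have [dY cY] := YC x Ux v; split; first exact: derivable_coord.
have E : \forall y \near x, 'D_v (fun y => Y y 0 j) y = 'D_v Y y 0 j.
  apply: filterS (open_nbhs_nbhs (conj Uo Ux)) => y Uy.
  by apply: derive_coord; have [] := YC y Uy v.
suff : 'D_v (fun y => Y y 0 j) y @[y --> x] --> 'D_v (fun y => Y y 0 j) x by [].
rewrite derive_coord //; apply/cvgrPdist_le => e e0.
move/cvgrPdist_le: cY => /(_ e e0) cY; near=> y.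
rewrite (near E y) //; apply: le_trans (near cY y _) => //.
apply: le_trans (coord_le_norm _ j); by rewrite !mxE.
Unshelve. all: by end_near. Qed.

Lemma smooth_on_C1 U Y vs : smooth_on U Y -> C1_on U (iter_derive vs Y).
Proof.
move=> sY x Ux v; have [_ d] := sY vs x Ux; have [c _] := sY (v :: vs) x Ux.
by split.
Qed.

Lemma deriveDv_rV U Y x v w : open U -> C1_on U Y -> U x ->
  'D_(v + w) Y x = 'D_v Y x + 'D_w Y x.
Proof.
move=> Uo YC Ux; apply/rowP => j; have D u : derivable Y x u by have [] := YC x Ux u.
have Dj u := derive_coord j (D u).
apply: etrans (etrans (esym (Dj (v + w))) (deriveDv v w Uo (C1_coord j Uo YC) Ux)) _.
by rewrite mxE; congr (_ + _); exact: Dj.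
Qed.

Lemma schwarz_rV U Y x v w : open U -> C1_on U Y ->
  C1_on U ('D_v Y) -> C1_on U ('D_w Y) -> U x ->
  'D_v ('D_w Y) x = 'D_w ('D_v Y) x.
Proof.
move=> Uo YC vC wC Ux; apply/rowP => j.
have E u y : U y -> 'D_u (fun y => Y y 0 j) y = 'D_u Y y 0 j.
  by move=> Uy; apply: derive_coord; have [] := YC y Uy u.
have C u : C1_on U ('D_u Y) -> C1_on U ('D_u (fun y => Y y 0 j)).
  move=> uC y Uy z; have [d1 d2] := C1_coord j Uo uC Uy z.
  have N t : U t -> \forall s \near t, 'D_u Y s 0 j = 'D_u (fun y => Y y 0 j) s.
    by move=> Ut; apply: filterS (open_nbhs_nbhs (conj Uo Ut)) => s Us; rewrite E.
  split; first exact: near_eq_derivable (N _ Uy) d1.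
  have N' : \forall s \near y, 'D_z (fun y => 'D_u Y y 0 j) s = 'D_z ('D_u (fun y => Y y 0 j)) s.
    by apply: filterS (open_nbhs_nbhs (conj Uo Uy)) => s Us; apply: near_eq_derive; exact: N.
  suff : 'D_z ('D_u (fun y => Y y 0 j)) s @[s --> y] --> 'D_z ('D_u (fun y => Y y 0 j)) y by [].
  rewrite -(nbhs_singleton N'); apply: cvg_trans d2.
  by apply: near_eq_cvg; apply: filterS N' => s ->.
have D u z : C1_on U ('D_u Y) -> 'D_z ('D_u Y) x 0 j = 'D_z ('D_u (fun y => Y y 0 j)) x.
  move=> uC; rewrite -derive_coord; last by have [] := uC x Ux z.
  apply: near_eq_derive.
  by apply: filterS (open_nbhs_nbhs (conj Uo Ux)) => s Us; rewrite E.
apply: (etrans (D w v wC)); apply: (etrans _ (esym (D v w vC))).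
exact: (schwarz Uo (C1_coord j Uo YC) (C _ vC) (C _ wC) Ux).
Qed.

End VectorValued.

Section VectorCalculus.
Variables (R : realType) (n m : nat).
Implicit Types (U : set 'rV[R]_n) (Y : 'rV[R]_n -> 'rV[R]_m) (x v w : 'rV[R]_n).

Definition partials Y x : 'M[R]_(n, m) := \matrix_(i < n) 'D_(delta_mx 0 i) Y x.

Lemma derive_partials U Y x v : open U -> C1_on U Y -> U x ->
  'D_v Y x = v *m partials Y x.
Proof.
move=> Uo YC Ux; rewrite mulmx_sum_row {1}[v]row_sum_delta.
elim: (index_enum _) => [|i s IH]; first by rewrite !big_nil derive0.
rewrite !big_cons (deriveDv_rV _ _ Uo YC) // IH deriveZv; last by have [] := YC x Ux (delta_mx 0 i).
by rewrite rowK.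
Qed.

Lemma second_derive_partials U Y x v w : open U -> C1_on U Y ->
  (forall u, C1_on U ('D_u Y)) -> U x ->
  'D_v ('D_w Y) x = \sum_i \sum_j (v 0 i * w 0 j) *: 'D_(delta_mx 0 i) ('D_(delta_mx 0 j) Y) x.
Proof.
move=> Uo YC YC2 Ux; pose e_ (k : 'I_n) : 'rV[R]_n := delta_mx 0 k.
have sum u (Z : 'rV[R]_n -> 'rV[R]_m) : C1_on U Z -> 'D_u Z x = \sum_i u 0 i *: 'D_(e_ i) Z x.
  move=> ZC; apply: etrans (derive_partials u Uo ZC Ux) _.
  by rewrite mulmx_sum_row; apply: eq_bigr => i _; rewrite rowK.
have comm u u' := schwarz_rV Uo YC (YC2 u) (YC2 u') Ux.
apply: etrans (sum v _ (YC2 w)) _; apply: eq_bigr => i _.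
have H : 'D_(e_ i) ('D_w Y) x = \sum_j w 0 j *: 'D_(e_ i) ('D_(e_ j) Y) x.
  apply: etrans (etrans (comm (e_ i) w) (sum w _ (YC2 (e_ i)))) _.
  by apply: eq_bigr => j _; exact: (congr1 (fun q => w 0 j *: q) (comm (e_ j) (e_ i))).
apply: etrans (congr1 (fun q => v 0 i *: q) H) _.
by rewrite scaler_sumr; apply: eq_bigr => j _; rewrite scalerA.
Qed.

(** Continuity of the finitely many partial derivatives, made uniform in the
    direction by linearity. *)
Lemma derive_equicontinuous U Y x e : open U -> C1_on U Y -> U x -> 0 < e ->
  \forall y \near x, U y /\ forall v, `|'D_v Y y - 'D_v Y x| <= e * `|v|.
Proof.
move=> Uo YC Ux e0.
have c0 : 0 < n.+1%:R :> R by [].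
have : \forall y \near x, U y /\ forall i, `|'D_(delta_mx 0 i) Y x - 'D_(delta_mx 0 i) Y y| <= e / n.+1%:R.
  apply: filterI; first exact: open_nbhs_nbhs.
  have H0 (i : 'I_n) : \forall y \near x, `|'D_(delta_mx 0 i) Y x - 'D_(delta_mx 0 i) Y y| <= e / n.+1%:R.
    have [_ /cvgrPdist_le H] := YC x Ux (delta_mx 0 i).
    exact: H _ (divr_gt0 e0 c0).
  exact: filter_forall H0.
apply: filterS => y [Uy H]; split=> // v.
rewrite !(derive_partials _ Uo YC) // -mulmxBr mulmx_sum_row.
rewrite (le_trans (ler_norm_sum _ _ _)) //.
rewrite (le_trans (y := \sum_(i < n) e / n.+1%:R * `|v|)) //.
  apply: ler_sum => i _; rewrite normrZ mulrC ler_pM // ?coord_le_norm //.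
  by rewrite linearB /= !rowK distrC.
rewrite sumr_const card_ord -[_ *+ n]mulr_natr mulrAC ler_wpM2r // -mulrA ger_pMr //.
by rewrite mulrC ler_pdivrMr // mul1r ler_nat.
Qed.

(** The mean value theorem on the segment from y to z, coordinate by
    coordinate, together with [derive_equicontinuous]. *)
Lemma strict_derivative U Y x e : open U -> C1_on U Y -> U x -> 0 < e ->
  exists2 d : R, 0 < d & forall y, ball x d y ->
    [/\ U y, forall v, `|'D_v Y y - 'D_v Y x| <= e * `|v| &
      forall z, ball x d z -> `|Y z - Y y - 'D_(z - y) Y x| <= e * `|z - y|].
Proof.
move=> Uo YC Ux e0.
have /nbhs_ballP [d /= d0 Hd] := derive_equicontinuous Uo YC Ux e0.
exists d => // y By; have [Uy Hy] := Hd y By; split=> // z Bz.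
apply: norm_le_coord => [|j]; first by rewrite mulr_ge0 // ltW.
have B t : 0 <= t <= 1 -> ball x d (y + t *: (z - y)).
  move=> /andP[t0 t1]; move: By Bz; rewrite -ball_normE /ball_ /= => By Bz.
  have -> : x - (y + t *: (z - y)) = (1 - t) *: (x - y) + t *: (x - z).
    rewrite !scalerBr !scalerBl !scale1r; apply/rowP => k; rewrite !mxE; ring.
  rewrite (le_lt_trans (ler_normD _ _)) // !normrZ !ger0_norm ?subr_ge0 //.
  have [->|t0'] := eqVneq t 0; first by rewrite subr0 mul1r mul0r addr0.
  have tp : 0 < t by rewrite lt_neqAle eq_sym t0'.
  rewrite (_ : d = (1 - t) * d + t * d); last by ring.
  by rewrite ler_ltD ?ltr_pM2l // ler_wpM2l ?subr_ge0 // ltW.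
have [|t t01] := @derivable_MVT _ _ (fun y => Y y 0 j) y (z - y).
  move=> t /B /Hd [Ut _]; apply: derivable_coord; by have [] := YC _ Ut (z - y).
have /Hd [Ut Ht] : ball x d (y + t *: (z - y)).
  by apply: B; case/andP: t01 => *; rewrite !ltW.
rewrite [y + (z - y)]addrC subrK derive_coord; last by have [] := YC _ Ut (z - y).
move=> E; rewrite !mxE E; apply: le_trans (Ht (z - y)).
by apply: le_trans (coord_le_norm _ j); rewrite !mxE.
Qed.

Lemma norm_mulmx_row (u : 'rV[R]_n) (B : 'M[R]_(n, m)) :
  `|u *m B| <= (\sum_i `|row i B|) * `|u|.
Proof.
rewrite mulmx_sum_row (le_trans (ler_norm_sum _ _ _)) // mulr_suml.
by apply: ler_sum => i _; rewrite normrZ mulrC ler_wpM2l // coord_le_norm.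
Qed.

Lemma mulmx_row_continuous (B : 'M[R]_(n, m)) :
  continuous (mulmxr B : 'rV[R]_n -> 'rV[R]_m).
Proof.
apply: bounded_linear_continuous; apply/linear_boundedP.
near=> r => u /=; rewrite (le_trans (norm_mulmx_row _ _)) // ler_wpM2r //.
Unshelve. all: by end_near. Qed.

(** Continuous partial derivatives imply differentiability, so that the
    Jacobian matrix is not a default value. *)
Lemma jacobian_partials U Y x : open U -> C1_on U Y -> U x -> 'J Y x = partials Y x.
Proof.
move=> Uo YC Ux; rewrite /jacobian.
suff -> : 'd Y x = mulmxr (partials Y x) :> ('rV[R]_n -> 'rV[R]_m).
  by apply/row_matrixP => i; rewrite !rowE mul_rV_lin1.
apply: diff_unique; first exact: mulmx_row_continuous.
apply/eqaddoP => e e0.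
have [d d0 H] := strict_derivative Uo YC Ux e0.
have [_ _ {}H] := H x (ballxx x d0).
have : \forall h \near (0 : 'rV[R]_n), `|h| < d by exact: nbhs0_lt.
apply: filterS => h hd.
have Bh : ball x d (h + x) by rewrite -ball_normE /ball_ /= distrC addrK.
have {H Bh} := H _ Bh; rewrite addrK => H; apply: le_trans H.
rewrite (derive_partials h Uo YC Ux) le_eqVlt; apply/orP; left; apply/eqP; congr (`|_|).
by rewrite -addrA -opprD.
Qed.

End VectorCalculus.

(** * Euclidean products and the second derivative test for the barrier *)

Section Dot.
Variables (R : realType) (n : nat).
Implicit Types (u v w : 'rV[R]_n) (a : R).

Lemma dotE u v : dot u v = (u *m v^T) 0 0.
Proof. by rewrite mxE; apply: eq_bigr => i _; rewrite mxE. Qed.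

Lemma dotC u v : dot u v = dot v u.
Proof. by apply: eq_bigr => i _; rewrite mulrC. Qed.

Lemma dotDl u v w : dot (u + v) w = dot u w + dot v w.
Proof. by rewrite !dotE mulmxDl mxE. Qed.

Lemma dotZl a u w : dot (a *: u) w = a * dot u w.
Proof. by rewrite !dotE -scalemxAl mxE. Qed.

Lemma dotNl u w : dot (- u) w = - dot u w.
Proof. by rewrite !dotE mulNmx mxE. Qed.

Lemma dotDr u v w : dot u (v + w) = dot u v + dot u w.
Proof. by rewrite dotC dotDl !(dotC u). Qed.

Lemma dotZr a u w : dot u (a *: w) = a * dot u w.
Proof. by rewrite dotC dotZl dotC. Qed.

Lemma dotNr u w : dot u (- w) = - dot u w.
Proof. by rewrite dotC dotNl dotC. Qed.

Lemma dot_suml (I : finType) (F : I -> 'rV[R]_n) w : dot (\sum_i F i) w = \sum_i dot (F i) w.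
Proof.
rewrite dotE mulmx_suml summxE.
by apply: eq_bigr => i _; rewrite dotE.
Qed.

Lemma dot_ge0 u : 0 <= dot u u.
Proof. by apply: sumr_ge0 => i _; rewrite -expr2 sqr_ge0. Qed.

Lemma dot_eq0 u : dot u u = 0 -> u = 0.
Proof.
move=> /eqP; rewrite psumr_eq0 => [/allP u0|i _]; last by rewrite -expr2 sqr_ge0.
by apply/rowP => i; apply/eqP; have := u0 i (mem_index_enum _); rewrite !mxE mulf_eq0 orbb.
Qed.

Lemma dot_le_norm u v : `|dot u v| <= n%:R * (`|u| * `|v|).
Proof.
rewrite (le_trans (ler_norm_sum _ _ _)) //.
rewrite (le_trans (y := \sum_(i < n) `|u| * `|v|)) //.
  by apply: ler_sum => i _; rewrite normrM ler_pM // coord_le_norm.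
by rewrite sumr_const card_ord mulr_natl.
Qed.

Lemma norm_le_dot u a : 0 <= a -> dot u u <= a ^+ 2 -> `|u| <= a.
Proof.
move=> a0 ua; apply: norm_le_coord => // i.
rewrite -(ler_pXn2r (ltn0Sn 1)) ?nnegrE // real_normK ?num_real //.
apply: le_trans ua; rewrite /dot (bigD1 i) //= -expr2 lerDl.
by apply: sumr_ge0 => j _; rewrite -expr2 sqr_ge0.
Qed.

End Dot.

Section SecondDerivative.
Variable R : realType.

(** If g1 had a positive derivative at 0, then g1 would be positive on some
    interval to the right of 0, and g would increase there. *)
Lemma second_derivative_test (g g1 : R -> R) (c d : R) : 0 < d ->
  (forall t : R, `|t| < d -> is_derive t 1 g (g1 t)) -> is_derive (0 : R) 1 g1 c ->
  (forall t : R, `|t| < d -> g t <= g 0) -> g1 0 = 0 /\ c <= 0.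
Proof.
move=> d0 gD g1D gmax.
have itv (t : R) : (t \in `](- d), d[%R) = (`|t| < d) by rewrite in_itv /= ltr_norml.
have g10 : g1 0 = 0.
  have [_ <-] : is_derive (0 : R) 1 g (g1 0) by apply: gD; rewrite normr0.
  have [||||] := @derive1_at_max R g (- d) d 0.
  - by rewrite ge0_cp // ltW.
  - by move=> t; rewrite itv => /gD[].
  - by rewrite itv normr0.
  - by move=> t; rewrite itv; exact: gmax.
  - by [].
split=> //; rewrite leNgt; apply/negP => c0.
have [dg1 cE] := g1D.
have : \forall h \near 0^', `|c - h^-1 * g1 h| < c.
  move: dg1; rewrite /derivable => /cvg_ex[l Hl].
  have lE : l = c by rewrite -cE; apply/esym/cvg_lim.
  move: Hl; rewrite lE => /cvgrPdist_lt /(_ c c0); apply: filterS => h.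
  by rewrite /= g10 subr0 addr0 [h *: 1]mulr1.
move=> [r /= r0 Hr].
pose b := Num.min d r / 2.
have m0 : 0 < Num.min d r by rewrite lt_min d0.
have b0 : 0 < b by rewrite divr_gt0.
have bm : b < Num.min d r by rewrite ltr_pdivrMr // ltr_pMr // ltr1n.
move: bm; rewrite lt_min => /andP[bd br].
have tb (t : R) : 0 <= t <= b -> `|t| < d by move=> /andP[t0 tb]; rewrite ger0_norm // (le_lt_trans tb).
have [||t] := @MVT R g g1 0 b b0.
- by move=> t; rewrite in_itv /= => /andP[t0 t1]; apply/gD/tb; rewrite !ltW.
- by apply: derivable_within_continuous => t; rewrite in_itv /= => /tb /gD[].
rewrite in_itv /= => /andP[t0 tb'] E.
have : g b <= g 0 by apply/gmax/tb; rewrite lexx ltW.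
rewrite -subr_le0 E subr0 leNgt pmulr_lgt0 // => /negP; apply.
have := Hr t; rewrite /ball_ /= sub0r normrN gtr0_norm // => /(_ (lt_trans tb' br) (lt0r_neq0 t0)).
rewrite ltr_norml => /andP[_]; rewrite ltrBlDr ltrDl mulrC pmulr_lgt0 ?invr_gt0 //.
Qed.

Lemma is_derive_dot n (a b : R -> 'rV[R]_n) (da db : 'rV[R]_n) (t : R) :
  is_derive t 1 a da -> is_derive t 1 b db ->
  is_derive t 1 (fun s => dot (a s) (b s)) (dot da (b t) + dot (a t) db).
Proof.
move=> [ad aE] [bd bE].
have H i : is_derive t 1 (fun s => a s 0 i * b s 0 i) (a t 0 i * db 0 i + b t 0 i * da 0 i).
  have A : is_derive t 1 (fun s => a s 0 i) (da 0 i).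
    by apply: DeriveDef; [exact: derivable_coord | rewrite derive_coord // aE].
  have B : is_derive t 1 (fun s => b s 0 i) (db 0 i).
    by apply: DeriveDef; [exact: derivable_coord | rewrite derive_coord // bE].
  exact: is_deriveM.
have := is_derive_sum H.
rewrite [X in is_derive _ _ X _](_ : _ = fun s => dot (a s) (b s)); last first.
  by apply/funext => s; rewrite fct_sumE.
move=> {}H; apply: is_derive_eq H _; rewrite /dot -big_split /=.
by apply: eq_bigr => i _; rewrite [LHS]addrC [b t 0 i * _]mulrC.
Qed.

End SecondDerivative.

Section Barrier.
Variables (R : realType) (n m : nat).

(** The first term is the squared distance to the origin with a sign; the
    exponential, a convex function of the height <z, y>, perturbs it. *)
Definition barrier (sg eps al rho : R) (y z : 'rV[R]_m) : R :=
  sg / 2 * dot z z + eps * expR (al * (dot z y - rho)).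

(** First and second order conditions at a maximum of the barrier along Y. The
    vector Z is the ambient gradient of the barrier at Y x, and kap * al the
    coefficient of the second derivative of its exponential term. *)
Lemma barrier_max (U : set 'rV[R]_n) (Y : 'rV[R]_n -> 'rV[R]_m) (x v : 'rV[R]_n)
    (sg eps al rho : R) (y : 'rV[R]_m) :
  open U -> C1_on U Y -> C1_on U ('D_v Y) -> U x ->
  (forall x', U x' -> barrier sg eps al rho y (Y x') <= barrier sg eps al rho y (Y x)) ->
  let kap := eps * al * expR (al * (dot (Y x) y - rho)) in
  let Z := sg *: Y x + kap *: y in
  dot ('D_v Y x) Z = 0 /\
  dot ('D_v ('D_v Y) x) Z + sg * dot ('D_v Y x) ('D_v Y x)
    + kap * al * dot ('D_v Y x) y ^+ 2 <= 0.
Proof.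
move=> Uo YC vC Ux Ymax kap Z.
have /nbhs_ballP [r /= r0 Hr] : nbhs x U by exact: open_nbhs_nbhs.
pose c := `|v| + 1.
have c0 : 0 < c by rewrite ltr_wpDl.
have UL (t : R) : `|t| < r / c -> U (x + t *: v).
  move=> tr; apply: Hr; rewrite -ball_normE /ball_ /= opprD addNKr normrN normrZ.
  by rewrite (le_lt_trans (y := `|t| * c)) ?ler_wpM2l ?lerDl // -ltr_pdivlMr.
pose a (t : R) := Y (x + t *: v).
pose b (t : R) := 'D_v Y (x + t *: v).
have aD (t : R) : `|t| < r / c -> is_derive t 1 a (b t).
  by move=> /UL Ut; apply: is_derive_line; have [] := YC _ Ut v.
have x0 : x + (0 : R) *: v = x by rewrite scale0r addr0.
have rc0 : 0 < r / c by rewrite divr_gt0.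
have bD : is_derive (0 : R) 1 b ('D_v ('D_v Y) x).
  rewrite -[in X in is_derive _ _ _ X]x0; apply: is_derive_line; rewrite x0.
  by have [] := vC x Ux v.
pose k (t : R) := eps * al * expR (al * (dot (a t) y - rho)).
have yD (t : R) : is_derive t 1 (fun=> y) 0 by exact: is_derive_cst.
have exD (t : R) : `|t| < r / c ->
    is_derive t 1 (fun t => expR (al * (dot (a t) y - rho)))
      (expR (al * (dot (a t) y - rho)) * (al * dot (b t) y)).
  move=> tr; have H := is_derive_dot (aD t tr) (yD t).
  have H1 : is_derive t 1 (fun t => al * (dot (a t) y - rho)) (al * dot (b t) y).
    have H2 := is_deriveB H (is_derive_cst rho t 1).
    apply: (is_derive_eq (is_deriveZ al H2)).
    by rewrite subr0 [dot (a t) 0]dotE trmx0 mulmx0 mxE addr0.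
  exact: (is_derive1_comp (is_derive_expR _) H1).
pose g (t : R) := barrier sg eps al rho y (a t).
pose g1 (t : R) := sg * dot (b t) (a t) + k t * dot (b t) y.
have gD (t : R) : `|t| < r / c -> is_derive t 1 g (g1 t).
  move=> tr; have H := is_derive_dot (aD t tr) (aD t tr).
  have H1 := is_deriveD (is_deriveZ (sg / 2) H) (is_deriveZ eps (exD t tr)).
  apply: (is_derive_eq H1); rewrite /g1 /k (dotC (a t) (b t)).
  rewrite /GRing.scale /=; lra.
have a0 : a 0 = Y x by rewrite /a x0.
have b0 : b 0 = 'D_v Y x by rewrite /b x0.
have k0 : k 0 = kap by rewrite /k a0.
have n0 : `|0 : R| < r / c by rewrite normr0.
set D2 := 'D_v ('D_v Y) x in bD *.
have g1D : is_derive (0 : R) 1 g1 (dot D2 Z + sg * dot ('D_v Y x) ('D_v Y x)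
    + kap * al * dot ('D_v Y x) y ^+ 2).
  have H1 := is_derive_dot bD (aD 0 n0).
  have H2 := is_derive_dot bD (yD 0).
  have kD : is_derive (0 : R) 1 k (kap * (al * dot (b 0) y)).
    apply: (is_derive_eq (is_deriveZ (eps * al) (exD 0 n0))).
    by rewrite -k0 /k /GRing.scale /=; ring.
  have H3 := is_deriveD (is_deriveZ sg H1) (is_deriveM kD H2).
  apply: (is_derive_eq H3); rewrite k0 a0 b0 /Z dotDr !dotZr.
  rewrite [dot _ 0]dotE trmx0 mulmx0 mxE addr0 /GRing.scale /=; ring.
have [|g10 le] := second_derivative_test rc0 gD g1D.
  by move=> t tr; rewrite /g a0; exact/Ymax/UL.
by split=> //; rewrite -g10 /g1 k0 a0 b0 /Z dotDr !dotZr.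
Qed.

End Barrier.

(** * Principal frames of an immersed hypersurface *)

Section Orthonormal.
Variables (R : realType) (n : nat).
Variables (E : 'I_n -> 'rV[R]_n.+1) (e : 'rV[R]_n.+1).
Hypotheses (EE : forall i j, dot (E i) (E j) = (i == j)%:R)
  (Ee : forall i, dot (E i) e = 0) (ee : dot e e = 1).

(** A square matrix with orthonormal rows has orthonormal columns. *)
Lemma orthonormal_expansion w : w = dot w e *: e + \sum_i dot w (E i) *: E i.
Proof.
pose M : 'M[R]_(n, n.+1) := \matrix_i E i.
(* The normal comes first because 1 + n, unlike n + 1, is convertible to n.+1. *)
pose Q : 'M[R]_n.+1 := (col_mx e M : 'M[R]_(1 + n, n.+1)).
have Me : M *m e^T = 0.
  apply/matrixP => i j; rewrite !ord1 [RHS]mxE -[RHS](Ee i) dotE.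
  by rewrite !mxE; apply: eq_bigr => l _; rewrite !mxE.
have QQ : Q *m Q^T = 1%:M.
  suff : (col_mx e M : 'M[R]_(1 + n, n.+1)) *m (col_mx e M)^T = 1%:M by [].
  rewrite tr_col_mx mul_col_row.
  have -> : e *m M^T = 0 by rewrite -[LHS]trmxK trmx_mul trmxK Me trmx0.
  rewrite Me (_ : e *m e^T = 1%:M); last first.
    by apply/matrixP => i j; rewrite !ord1 -dotE ee mxE.
  rewrite (_ : M *m M^T = 1%:M) -?scalar_mx_block //.
  apply/matrixP => i j; rewrite [RHS]mxE -EE dotE.
  by rewrite !mxE; apply: eq_bigr => l _; rewrite !mxE.
rewrite -[LHS](mulmx1 w) -(mulmx1C QQ) mulmxA.
have -> : w *m Q^T = row_mx (w *m e^T) (w *m M^T) :> 'rV[R]_(1 + n).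
  suff : w *m (col_mx e M)^T = row_mx (w *m e^T) (w *m M^T) by [].
  by rewrite tr_col_mx mul_mx_row.
rewrite /Q (mul_row_col (w *m e^T)) [w *m e^T]mx11_scalar mul_scalar_mx -dotE.
congr (_ + _); rewrite mulmx_sum_row; apply: eq_bigr => i _.
rewrite rowK; congr (_ *: _); rewrite dotE !mxE.
by apply: eq_bigr => l _; rewrite !mxE.
Qed.

Lemma parseval w : dot w w = dot w e ^+ 2 + \sum_i dot w (E i) ^+ 2.
Proof.
rewrite {2}[w]orthonormal_expansion dotDr dotZr expr2; congr (_ + _).
rewrite dotC dot_suml; apply: eq_bigr => i _.
by rewrite dotZl [dot (E i) w]dotC expr2.
Qed.

Lemma normal_span w : (forall i, dot w (E i) = 0) -> w = dot w e *: e.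
Proof.
move=> wE; rewrite {1}[w]orthonormal_expansion big1 ?addr0 // => i _.
by rewrite wE scale0r.
Qed.

End Orthonormal.

(** The vectors v i are principal directions, orthonormal for the metric
    induced by Y. The curvatures mu are a reordering of lam: only symmetric
    functions matter afterwards, so the permutation is not tracked. *)
Lemma principal_frame (R : realType) (n : nat) (U : set 'rV[R]_n)
    (Y : 'rV[R]_n -> 'rV[R]_n.+1) (x : 'rV[R]_n) (e : 'rV[R]_n.+1) (lam : 'rV[R]_n) :
  open U -> C1_on U Y -> (forall u, C1_on U ('D_u Y)) -> U x ->
  row_free ('J Y x) -> (forall i, dot ('D_(delta_mx 0 i) Y x) e = 0) ->
  char_poly (invmx (\matrix_(i, j) dot ('D_(delta_mx 0 i) Y x) ('D_(delta_mx 0 j) Y x)) *m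
     \matrix_(i, j) dot ('D_(delta_mx 0 i) ('D_(delta_mx 0 j) Y) x) e)
   = \prod_(i < n) ('X - (lam 0 i)%:P) ->
  exists (v : 'I_n -> 'rV[R]_n) (mu : 'rV[R]_n),
    [/\ forall i j, dot ('D_(v i) Y x) ('D_(v j) Y x) = (i == j)%:R,
        forall i, dot ('D_(v i) Y x) e = 0,
        forall i, dot ('D_(v i) ('D_(v i) Y) x) e = mu 0 i &
        forall m, sigma m mu = sigma m lam].
Proof.
move=> Uo YC YC2 Ux; rewrite (jacobian_partials Uo YC Ux).
set J := partials Y x => Jf Je; set g := \matrix_(i, j) _; set h := \matrix_(i, j) _ => cp.
have gE : g = J *m J^T.
  apply/matrixP => i j; rewrite mxE dotE !mxE.
  by apply: eq_bigr => l _; rewrite !mxE.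
have gs : g^T = g by rewrite gE trmx_mul trmxK.
have hs : h^T = h.
  apply/matrixP => i j; rewrite [LHS]mxE [LHS]mxE [RHS]mxE.
  exact: (congr1 (dot^~ e) (schwarz_rV Uo YC (YC2 (delta_mx 0 j)) (YC2 (delta_mx 0 i)) Ux)).
have gp : pos_def g.
  move=> v v0; rewrite gE mulmxA -mulmxA -trmx_mul; apply: row_sq_gt0.
  by rewrite mulmx_free_eq0.
have [V [mu [Vg Vh]]] := simultaneous_diag gs hs gp.
have DvE (i : 'I_n) : 'D_(row i V) Y x = row i (V *m J).
  by rewrite row_mul; exact: (derive_partials _ Uo YC Ux).
have rowdot p (B C : 'M[R]_(n, p)) i j : dot (row i B) (row j C) = (B *m C^T) i j.
  by rewrite dotE !mxE; apply: eq_bigr => l _; rewrite !mxE.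
exists (fun i => row i V), mu; split.
- move=> i j; rewrite !DvE rowdot trmx_mul mulmxA -(mulmxA V) -gE Vg.
  by rewrite mxE.
- move=> i; rewrite DvE row_mul mulmx_sum_row dot_suml big1 // => j _.
  by rewrite dotZl rowK Je mulr0.
- move=> i; transitivity ((V *m h *m V^T) i i); last by rewrite Vh mxE eqxx mulr1n.
  apply: etrans (congr1 (dot^~ e) (second_derive_partials (row i V) (row i V) Uo YC YC2 Ux)) _.
  rewrite /= dot_suml mxE.
  under eq_bigr => j _.
    rewrite dot_suml; under eq_bigr => l _ do rewrite dotZl [row i V 0 j]mxE [row i V 0 l]mxE.
    over.
  rewrite exchange_big /=; apply: eq_bigr => l _.
  rewrite !mxE mulr_suml; apply: eq_bigr => j _.
  by rewrite [h j l]mxE mulrAC.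
- move=> m; apply: sigma_roots; rewrite -cp.
  by rewrite (char_poly_simultaneous Vg Vh).
Qed.

(** * Quantitative estimates *)

(** In [normal_chord_trivial], w is the length of a chord in the parameter
    domain, b the length of its image, q the bound of b that comes from
    normality, and a the length of the linearized chord. *)
Lemma chord_length_le0 (R : realType) (c eta w a b q : R) : 0 < c -> c * w <= a -> b <= q ->
  a <= b + eta * w -> q <= 2 * (c / 4) * w -> eta * w <= c / 4 * w -> w <= 0.
Proof.
move=> c0 h1 h2 h3 h4 h5; rewrite -(pmulr_rle0 _ c0); lra.
Qed.

Section Immersion.
Variables (R : realType) (n m : nat) (U : set 'rV[R]_n) (Y : 'rV[R]_n -> 'rV[R]_m).
Variables (x : 'rV[R]_n).
Hypotheses (Uo : open U) (YC : C1_on U Y) (Ux : U x) (Yf : row_free ('J Y x)).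

(** The Jacobian has a right inverse, which is bounded. *)
Lemma immersion_lower_bound : exists2 c : R, 0 < c & forall v, c * `|v| <= `|'D_v Y x|.
Proof.
have Pf : row_free (partials Y x) by rewrite -(jacobian_partials Uo YC Ux).
pose k := \sum_i `|row i (pinvmx (partials Y x))| + 1.
have k0 : 0 < k by rewrite ltr_wpDl // sumr_ge0.
exists k^-1; first by rewrite invr_gt0.
move=> v; rewrite (derive_partials v Uo YC Ux) ler_pdivrMl //.
rewrite -{1}[v](mulmx1 v) -(mulmxVp Pf) mulmxA.
rewrite (le_trans (norm_mulmx_row _ _)) // ler_wpM2r // lerDl //.
Qed.

Lemma immersion_near_bound : exists2 c : R, 0 < c &
  \forall y \near x, U y /\ forall v, c * `|v| <= `|'D_v Y y|.
Proof.
have [c c0 H] := immersion_lower_bound.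
exists (c / 2); first by rewrite divr_gt0.
have c20 : 0 < c / 2 by rewrite divr_gt0.
apply: filterS (derive_equicontinuous Uo YC Ux c20) => y [Uy Hy]; split=> // v.
have T : `|'D_v Y x| <= `|'D_v Y y - 'D_v Y x| + `|'D_v Y y|.
  rewrite distrC; apply: le_trans (ler_normD _ _); by rewrite subrK.
rewrite -(lerD2l (c / 2 * `|v|)) -mulrDl -splitr.
by apply: le_trans (H v) (le_trans T _); rewrite lerD2r; exact: Hy.
Qed.

(** On a short chord, Y z - Y y differs from the tangent vector
    'D_(z - y) Y y by a small fraction of its length; if the chord is normal at
    y, its length is therefore a small fraction of itself. *)
Lemma normal_chord_trivial : exists2 d : R, 0 < d & forall y z, ball x d y -> ball x d z ->
  forall (e : 'rV[R]_m) (t : R), dot e e = 1 -> (forall v, dot ('D_v Y y) e = 0) ->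
  Y z - Y y = t *: e -> z = y.
Proof.
have [c c0 H] := immersion_lower_bound.
pose eta := c / (4 * m.+1%:R).
have m0 : 0 < m.+1%:R :> R by [].
have eta0 : 0 < eta by rewrite divr_gt0 // mulr_gt0.
have etaE : eta * m.+1%:R = c / 4 by rewrite /eta; field; rewrite gt_eqF.
have [d d0 Hd] := strict_derivative Uo YC Ux eta0.
exists d => // y z By Bz e t e1 eN YE.
have [_ /(_ (z - y)) H1 /(_ z Bz) H2] := Hd y By.
have H3 := H (z - y).
have e1' : `|e| <= 1 by apply: norm_le_dot; rewrite // e1 expr1n.
have tE : t = dot (Y z - Y y - 'D_(z - y) Y y) e.
  by rewrite dotDl dotNl eN YE dotZl e1 subr0 mulr1.
have le1 : `|Y z - Y y - 'D_(z - y) Y y| <= 2 * eta * `|z - y|.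
  have := ler_normD (Y z - Y y - 'D_(z - y) Y x) ('D_(z - y) Y x - 'D_(z - y) Y y).
  rewrite subrKA => /le_trans; apply; rewrite distrC in H1.
  by apply: le_trans (lerD H2 H1) _; rewrite -mulrA mulr_natl mulr2n.
have tle : `|t| <= 2 * (c / 4) * `|z - y|.
  rewrite tE (le_trans (dot_le_norm _ _)) // -etaE.
  have A0 := normr_ge0 (Y z - Y y - 'D_(z - y) Y y).
  move: le1 A0 (normr_ge0 e) e1'; set a := `|_|; set b := `|e| => le1 A0 b0 b1.
  have ab : a * b <= a by rewrite ler_piMr.
  have : m%:R * (a * b) <= m.+1%:R * (2 * eta * `|z - y|).
    by rewrite ler_pM // ?mulr_ge0 // ?ler_nat // (le_trans ab).
  by move/le_trans; apply; rewrite le_eqVlt; apply/orP; left; apply/eqP; ring.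
have le2 : `|Y z - Y y| <= `|t|.
  by rewrite YE normrZ ler_piMr.
have le3 : `|'D_(z - y) Y x| <= `|Y z - Y y| + eta * `|z - y|.
  have := ler_normB (Y z - Y y) (Y z - Y y - 'D_(z - y) Y x).
  by rewrite subKr => /le_trans; apply; rewrite lerD2l.
have eta4 : eta <= c / 4.
  by rewrite -etaE ler_peMr ?(ltW eta0) // ler1n.
apply/eqP; rewrite -subr_eq0 -normr_le0.
have : eta * `|z - y| <= c / 4 * `|z - y| by rewrite ler_wpM2r.
move=> h5; exact: (chord_length_le0 c0 H3 le2 le3 tle h5).
Qed.

End Immersion.

Section RealEstimate.
Variable R : realType.

(** Here t is - <y, e>, xx is |X|^2 and xy is <X, y>; the conclusion bounds
    |X - r y|^2. The condition u >= - kap selects the positive root u of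
    u^2 = xx - kap^2 (1 - t^2), so that u is close to r. *)
Lemma barrier_estimate (r dl u t kap xx xy : R) : 0 < r -> 0 < dl -> dl <= 1 -> 4 * dl <= r ^+ 2 ->
  0 < t -> t <= 1 -> 1 - t ^+ 2 <= dl -> 0 <= kap -> kap <= dl -> - kap <= u ->
  xx = u ^+ 2 + kap ^+ 2 * (1 - t ^+ 2) -> r ^+ 2 - dl <= xx -> xx <= r ^+ 2 + dl ->
  u * t - kap * (1 - t ^+ 2) <= xy ->
  xx - 2 * r * xy + r ^+ 2 <= dl * (5 + 2 * r ^+ 2 + 2 * r).
Proof.
move=> r0 d0 d1 dr t0 t1 td k0 kd ku xxE xl xu xyl.
have t2 : 0 <= 1 - t ^+ 2 by rewrite subr_ge0 expr_le1 // ltW.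
have kk : kap ^+ 2 <= dl ^+ 2 by rewrite ler_pXn2r ?nnegrE // ltW.
have dd : dl ^+ 2 <= dl by rewrite expr2 ler_piMl // ltW.
have kt : kap ^+ 2 * (1 - t ^+ 2) <= dl.
  rewrite (le_trans (y := kap ^+ 2)) ?(le_trans kk) // ler_piMr ?sqr_ge0 //.
  by rewrite lerBlDr lerDl sqr_ge0.
have u2 : r ^+ 2 - 2 * dl <= u ^+ 2 by lra.
have u0 : 0 < u.
  rewrite ltNge; apply/negP => u0.
  have : u ^+ 2 <= kap ^+ 2 by rewrite -sqrrN ler_pXn2r ?nnegrE ?oppr_ge0 // lerNl.
  lra.
(* A lower bound of sqrt (r^2 - 2 dl), hence of u. *)
pose b := r - 2 * dl / r.
have bE : b * r = r ^+ 2 - 2 * dl by rewrite /b; field; rewrite gt_eqF.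
have b0 : 0 < b by rewrite -(pmulr_lgt0 _ r0) bE; lra.
have br : b <= r by rewrite /b lerBlDr lerDl divr_ge0 ?mulr_ge0 // ltW.
clearbody b.
have bu : b <= u.
  rewrite -(ler_pXn2r (ltn0Sn 1)) ?nnegrE ?(ltW b0) ?(ltW u0) //.
  rewrite (le_trans _ u2) // -bE expr2 ler_pM2l //.
have tt : 1 - dl <= t.
  have : t ^+ 2 <= t by rewrite expr2 ler_piMl // ltW.
  lra.
have ut : b * (1 - dl) <= u * t by apply: ler_pM; rewrite ?subr_ge0 // ltW.
have key : r * (b * (1 - dl) - dl ^+ 2) <= r * xy.
  rewrite ler_pM2l //; have : kap * (1 - t ^+ 2) <= dl ^+ 2 by rewrite expr2 ler_pM.
  lra.
have rd : r * dl ^+ 2 <= r * dl by rewrite ler_pM2l.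
have E : r * (b * (1 - dl) - dl ^+ 2) = (r ^+ 2 - 2 * dl) * (1 - dl) - r * dl ^+ 2.
  by rewrite -bE; ring.
rewrite E in key.
have : 0 <= dl ^+ 2 by rewrite sqr_ge0.
nra.
Qed.

End RealEstimate.

(** * Consequences of criticality on the hypersurface *)

Section Weighted.
Variables (R : realType) (n K : nat) (mu : 'rV[R]_n).
Hypotheses (Kn : (K < n)%N) (mu_k : Gamma K.+1 mu).

Let tau i := sigma K (zero_at i mu).

(** Summing the second order conditions in the principal directions with the
    positive weights tau i, that is, applying the linearization of sigma_k; the
    two identities for the sums of tau i and mu_i tau i produce sigma_(k-1) and
    sigma_k. The index K stands for k - 1. *)
Lemma weighted_sum (zeta sg ka : R) (q : 'I_n -> R) :
  (forall i, mu 0 i * zeta + sg + ka * q i ^+ 2 <= 0) ->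
  K.+1%:R * sigma K.+1 mu * zeta + sg * ((n - K)%:R * sigma K mu)
    + ka * \sum_i tau i * q i ^+ 2 <= 0.
Proof.
move=> H; rewrite -(sum_mu_sigma mu K) -(sum_sigma_zero_at mu Kn).
rewrite mulr_suml !mulr_sumr -!big_split /=; apply: sumr_le0 => i _.
rewrite (_ : _ + _ = tau i * (mu 0 i * zeta + sg + ka * q i ^+ 2)); last first.
  by rewrite /tau; ring.
by rewrite mulr_ge0_le0 // ltW // /tau (Gamma_zero_at _ mu_k).
Qed.

(** The part of [weighted_sum] that comes from |X|^2 / 2 has a good sign, and
    what remains is proportional to kap, whatever its size: an estimate that
    does not degenerate when the barrier becomes small. *)
Lemma weighted_barrier (u t sg kap al : R) (q : 'I_n -> R) :
  0 <= sg * ((n - K)%:R * sigma K mu - K.+1%:R * sigma K.+1 mu * u) ->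
  0 < kap -> 0 < al -> \sum_i q i ^+ 2 = 1 - t ^+ 2 ->
  (forall i, mu 0 i * (- sg * u - kap * t) + sg + kap * al * q i ^+ 2 <= 0) ->
  al * (1 - t ^+ 2) <= K.+1%:R * t * sigma 1 mu.
Proof.
move=> hu k0 a0 qE /weighted_sum H.
have sK : 0 < sigma K.+1 mu by apply: mu_k; rewrite ltnS leq0n leqnn.
have s1 : 0 < sigma 1 mu by apply: mu_k.
have le1 : sigma K.+1 mu * (1 - t ^+ 2) <= (\sum_i tau i * q i ^+ 2) * sigma 1 mu.
  rewrite -qE mulr_sumr mulr_suml; apply: ler_sum => i _.
  by rewrite mulrAC ler_wpM2r ?sqr_ge0 // sigma_le_zero_at.
have le2 : al * (\sum_i tau i * q i ^+ 2) <= K.+1%:R * sigma K.+1 mu * t.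
  rewrite -(ler_pM2l k0); move: H hu; set S := \sum_i _; move=> *; lra.
rewrite -(ler_pM2l sK).
apply: (le_trans (y := al * ((\sum_i tau i * q i ^+ 2) * sigma 1 mu))).
  by rewrite mulrCA ler_pM2l.
rewrite mulrA (_ : sigma _ _ * _ = K.+1%:R * sigma K.+1 mu * t * sigma 1 mu); last by ring.
by rewrite ler_pM2r.
Qed.

Lemma weighted_sign (zeta ka : R) (q : 'I_n -> R) : 0 <= ka ->
  (forall i, mu 0 i * zeta + 1 + ka * q i ^+ 2 <= 0) -> zeta < 0.
Proof.
move=> k0 /weighted_sum H.
have sK : 0 < sigma K.+1 mu by apply: mu_k; rewrite ltnS leq0n leqnn.
have sK' : 0 < sigma K mu.
  by case: (K) mu_k => [|K'] G; [rewrite sigma0 | apply: G; rewrite ltnS leq0n ltnW].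
have c1 : 0 < K.+1%:R * sigma K.+1 mu by rewrite mulr_gt0.
have c2 : 0 < (n - K)%:R * sigma K mu by rewrite mulr_gt0 // ltr0n subn_gt0.
have c3 : 0 <= ka * \sum_i tau i * q i ^+ 2.
  rewrite mulr_ge0 // sumr_ge0 // => i _.
  by rewrite mulr_ge0 ?sqr_ge0 // ltW // (Gamma_zero_at _ mu_k).
rewrite -(pmulr_rlt0 _ c1); lra.
Qed.

(** Without barrier, all the terms of a weighted sum are nonpositive while the
    sum is nonnegative. *)
Lemma weighted_umbilic (u sg : R) : sg != 0 ->
  0 <= sg * ((n - K)%:R * sigma K mu - K.+1%:R * sigma K.+1 mu * u) ->
  (forall i, mu 0 i * (- sg * u) + sg <= 0) -> forall i, u * mu 0 i = 1.
Proof.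
move=> sg0 hu H i.
have H' j : sg * (1 - u * mu 0 j) <= 0.
  by apply: le_trans (H j); rewrite le_eqVlt; apply/orP; left; apply/eqP; ring.
have t0 j : 0 < tau j by rewrite /tau (Gamma_zero_at _ mu_k).
have E : sg * ((n - K)%:R * sigma K mu - K.+1%:R * sigma K.+1 mu * u) =
    \sum_j tau j * (sg * (1 - u * mu 0 j)).
  rewrite -(sum_mu_sigma mu K) -(sum_sigma_zero_at mu Kn) mulr_suml -sumrB mulr_sumr.
  by apply: eq_bigr => j _; rewrite /tau; ring.
have : \sum_j tau j * - (sg * (1 - u * mu 0 j)) == 0.
  rewrite eq_le; apply/andP; split.
    by under eq_bigr do rewrite mulrN; rewrite sumrN -E oppr_le0.
  by apply: sumr_ge0 => j _; rewrite mulr_ge0 ?oppr_ge0 // ltW.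
rewrite psumr_eq0 => [/allP /(_ i (mem_index_enum _))|j _]; last first.
  by rewrite mulr_ge0 ?oppr_ge0 // ltW.
rewrite /= mulf_eq0 (gt_eqF (t0 i)) /= oppr_eq0 mulf_eq0 (negbTE sg0) /= subr_eq0.
by move=> /eqP <-.
Qed.

End Weighted.

Section Surface.
Variables (R : realType) (n : nat) (M : topologicalType) (A : set (chart R n M)).
Variables (X e : M -> 'rV[R]_n.+1) (lam : M -> 'rV[R]_n).
Hypotheses (hM : closed_manifold A) (hX : smooth_embedding A X).
Hypotheses (he : inward_unit_normal A X e) (hlam : principal_curvatures A X e lam).

Let Y (c : chart R n M) := local_param X c.
Let U (c : chart R n M) := coord c @` dom c.

Lemma chart_C1 c : A c -> [/\ open (U c), C1_on (U c) (Y c) &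
  forall u, C1_on (U c) ('D_u (Y c))].
Proof.
move=> Ac; have [[[Ach _ _] _ _] _ _ _] := hM; have [s _ _ _] := hX.
have [_ Uo _ _ _] := Ach c Ac; split=> //.
  exact: (smooth_on_C1 [::] (s c Ac)).
move=> u; exact: (smooth_on_C1 [:: u] (s c Ac)).
Qed.

Lemma Y_coord c p : A c -> dom c p -> Y c (coord c p) = X p.
Proof.
move=> Ac cp; have [[[Ach _ _] _ _] _ _ _] := hM; have [_ _ K _ _] := Ach c Ac.
by rewrite /Y /local_param /= K.
Qed.

Lemma normal_tangent c p v : A c -> dom c p -> dot ('D_v (Y c) (coord c p)) (e p) = 0.
Proof.
move=> Ac cp; have [Uo YC _] := chart_C1 Ac.
have Up : U c (coord c p) by exists p.
have [_ H _] := he p.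
rewrite (derive_partials v Uo YC Up) mulmx_sum_row dot_suml big1 // => i _.
by rewrite dotZl rowK [dot _ _]H ?mulr0.
Qed.

Lemma surface_frame c p : A c -> dom c p ->
  exists (v : 'I_n -> 'rV[R]_n) (mu : 'rV[R]_n),
    [/\ forall i j, dot ('D_(v i) (Y c) (coord c p)) ('D_(v j) (Y c) (coord c p)) = (i == j)%:R,
        forall i, dot ('D_(v i) (Y c) (coord c p)) (e p) = 0,
        forall i, dot ('D_(v i) ('D_(v i) (Y c)) (coord c p)) (e p) = mu 0 i &
        forall m, sigma m mu = sigma m (lam p)].
Proof.
move=> Ac cp; have [Uo YC YC2] := chart_C1 Ac.
have Up : U c (coord c p) by exists p.
have [_ Yf _ _] := hX; have [_ H _] := he p.
apply: (principal_frame Uo YC YC2 Up (Yf c p Ac cp)).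
  by move=> i; exact: H.
exact: hlam Ac cp.
Qed.

(** Transfer of [barrier_max] to the hypersurface. Since Z is normal, the
    second derivatives of X enter only through the second fundamental form,
    whence the curvatures mu. *)
Lemma critical_frame p : exists (E : 'I_n -> 'rV[R]_n.+1) (mu : 'rV[R]_n),
  [/\ forall i j, dot (E i) (E j) = (i == j)%:R,
      forall i, dot (E i) (e p) = 0,
      forall m, sigma m mu = sigma m (lam p) &
      forall (sg eps al rho : R) (y : 'rV[R]_n.+1),
        (forall q, barrier sg eps al rho y (X q) <= barrier sg eps al rho y (X p)) ->
        let kap := eps * al * expR (al * (dot (X p) y - rho)) in
        let Z := sg *: X p + kap *: y in
        Z = dot Z (e p) *: e p /\
        forall i, mu 0 i * dot Z (e p) + sg + kap * al * dot y (E i) ^+ 2 <= 0].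
Proof.
have [[[Ach cov _] _ _] _ _ _] := hM.
have [c Ac cp] := cov p; have [Uo YC YC2] := chart_C1 Ac.
have Up : U c (coord c p) by exists p.
have [v [mu [EE Ee Se sE]]] := surface_frame Ac cp.
exists (fun i => 'D_(v i) (Y c) (coord c p)), mu; split=> // sg eps al rho y max kap Z.
have ee : dot (e p) (e p) = 1 by have [] := he p.
have XE := Y_coord Ac cp.
have max' z : U c z -> barrier sg eps al rho y (Y c z) <= barrier sg eps al rho y (Y c (coord c p)).
  by move=> [q cq <-]; rewrite XE (Y_coord Ac cq).
have crit i := barrier_max Uo YC (YC2 (v i)) Up max'.
have ZE : Z = dot Z (e p) *: e p.
  apply: (normal_span EE Ee ee) => i; have [H _] := crit i.
  by rewrite dotC /Z /kap -XE.
split=> // i; have [_] := crit i.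
rewrite XE -/kap -/Z {1}ZE dotZr Se EE eqxx mulr1.
by rewrite [X in X + sg]mulrC [dot y _]dotC.
Qed.

Lemma near_chart c p (P : set 'rV[R]_n) : A c -> dom c p ->
  (\forall x \near coord c p, P x) -> \forall q \near p, dom c q /\ P (coord c q).
Proof.
move=> Ac cp Px; have [[[Ach _ _] _ _] _ _ _] := hM.
have [domo _ _ cc _] := Ach c Ac.
apply: filterI; first exact: open_nbhs_nbhs.
exact: (cc p cp _ Px).
Qed.

(** The principal directions v i are unit vectors for the induced metric, so
    their coordinates in a chart are bounded; as e has unit length, so are the
    values of the second fundamental form on them. *)
Lemma mean_curvature_near (p : M) : exists h, \forall q \near p, sigma 1 (lam q) <= h.
Proof.
have [[[Ach cov _] _ _] _ _ _] := hM; have [_ Yf _ _] := hX.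
have [c Ac cp] := cov p; have [Uo YC YC2] := chart_C1 Ac.
have Up : U c (coord c p) by exists p.
have [k k0 Hk] := immersion_near_bound Uo YC Up (Yf c p Ac cp).
pose D2 (ij : 'I_n * 'I_n) : 'rV[R]_n -> 'rV[R]_n.+1 :=
  'D_(delta_mx 0 ij.1) ('D_(delta_mx 0 ij.2) (Y c)).
pose b := \sum_ij `|D2 ij (coord c p)| + 1.
have b0 : 0 <= b by rewrite addr_ge0 // sumr_ge0.
have HD : \forall x \near coord c p, forall ij, `|D2 ij x| <= b.
  have HD1 ij : \forall x \near coord c p, `|D2 ij x| <= b.
    have [_ /cvgrPdist_le /(_ 1 ltr01)] := YC2 (delta_mx 0 ij.2) _ Up (delta_mx 0 ij.1).
    apply: filterS => x; rewrite -/(D2 ij x) -/(D2 ij _) distrC => H.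
    rewrite -[D2 ij x](subrK (D2 ij (coord c p))) (le_trans (ler_normD _ _)) //.
    rewrite addrC lerD // (bigD1 ij) //= lerDl; exact: sumr_ge0.
  exact: (@filter_forall _ _ (fun ij x => `|D2 ij x| <= b) (nbhs (coord c p)) _ HD1).
exists (n%:R * (n.+1%:R * (n%:R * (n%:R * (k^-1 * k^-1 * b))))).
have Hn := near_chart Ac cp (@filterI _ _ (nbhs_filter _) _ _ Hk HD).
apply: filterS Hn => q [cq [[Uq Hq] Dq]].
have [v [mu [EE Ee Se <-]]] := surface_frame Ac cq.
have -> : sigma 1 mu = \sum_i mu 0 i.
  have := sum_mu_sigma mu 0; rewrite mul1r => <-.
  by apply: eq_bigr => i _; rewrite sigma0 mulr1.
have const_sum (F : 'I_n -> R) a : (forall i, F i <= a) -> \sum_i F i <= n%:R * a.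
  move=> Fa; apply: (le_trans (y := \sum_(i < n) a)); first exact: ler_sum.
  by rewrite sumr_const card_ord mulr_natl.
apply: (const_sum) => i.
have e1 : `|e q| <= 1 by apply: norm_le_dot; rewrite // expr1n; have [-> _ _] := he q.
have v1 j : `|v i 0 j| <= k^-1.
  apply: le_trans (coord_le_norm _ j) _.
  rewrite -[k^-1]mulr1 ler_pdivlMl //; apply: le_trans (Hq (v i)) _.
  by apply: norm_le_dot; rewrite // expr1n EE eqxx.
rewrite -Se; apply: le_trans (ler_norm _) _; apply: le_trans (dot_le_norm _ _) _.
rewrite ler_wpM2l //.
apply: le_trans (ler_piMr (normr_ge0 _) e1) _.
have -> : `|'D_(v i) ('D_(v i) (Y c)) (coord c q)| =
    `|\sum_j \sum_l (v i 0 j * v i 0 l) *: D2 (j, l) (coord c q)|.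
  exact: (congr1 _ (second_derive_partials (v i) (v i) Uo YC YC2 Uq)).
apply: le_trans (ler_norm_sum _ _ _) _; apply: (const_sum) => j.
apply: le_trans (ler_norm_sum _ _ _) _; apply: (const_sum) => l.
rewrite normrZ normrM; apply: ler_pM; [by rewrite mulr_ge0 | by [] | by apply: ler_pM | exact: Dq].
Qed.

Lemma mean_curvature_bounded : exists h, forall p, sigma 1 (lam p) <= h.
Proof.
have [_ /compact_near_coveringP cM _ _] := hM.
have [|h Hh] := filter_ex (F := +oo_R) (cM R +oo_R (fun h p => sigma 1 (lam p) <= h) _ _).
  move=> p _; have [h Hh] := mean_curvature_near p.
  exists ([set q | sigma 1 (lam q) <= h], [set b | h <= b]).
    by split => //=; apply: nbhs_pinfty_ge; exact: num_real.
  by move=> [q b] /= [/le_trans]; apply.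
by exists h => p; exact: Hh.
Qed.

Lemma embedding_continuous : continuous X.
Proof.
by have [_ _ _ Xo] := hX; apply/continuousP => V Vo; apply/Xo; exists V.
Qed.

End Surface.

Lemma dot_continuous (R : realType) (T : topologicalType) m (f g : T -> 'rV[R]_m) :
  continuous f -> continuous g -> continuous (fun q => dot (f q) (g q)).
Proof.
move=> fc gc; apply: continuous_big => [|i _ q]; first exact: add_continuous.
have cc (h : T -> 'rV[R]_m) : continuous h -> h q' 0 i @[q' --> q] --> h q 0 i.
  move=> hc; exact: (@continuous_comp _ _ _ h (fun z : 'rV[R]_m => z 0 i) q (hc q)
    (@coord_continuous _ 1 m 0 i (h q))).
by apply: cvgM; exact: cc.
Qed.

Lemma barrier_continuous (R : realType) (T : topologicalType) m (f : T -> 'rV[R]_m) sg eps al rho y :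
  continuous f -> continuous (fun q => barrier sg eps al rho y (f q)).
Proof.
move=> fc q; apply: cvgD; first by apply: cvgMr; exact: (dot_continuous fc fc).
apply: cvgMr; apply: continuous_cvg; first exact: continuous_expR.
apply: cvgMr; apply: cvgB; last exact: cvg_cst.
by apply: (dot_continuous fc) => ?; exact: cvg_cst.
Qed.

(** * The maximum principle and the round sphere *)

Lemma compact_max (R : realType) (T : topologicalType) (f : T -> R) :
  compact [set: T] -> [set: T] !=set0 -> continuous f -> exists p, forall q, f q <= f p.
Proof.
move=> cT T0 fc; have [|p _ H] := compact_EVT_max T0 cT (f := f).
  exact: continuous_subspaceT.
by exists p => q; apply: H; rewrite inE.
Qed.

Section Sphere.
Variables (R : realType) (n K : nat) (M : topologicalType) (A : set (chart R n M)).
Variables (X e : M -> 'rV[R]_n.+1) (lam : M -> 'rV[R]_n) (sg : R).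
Hypotheses (hM : closed_manifold A) (hX : smooth_embedding A X).
Hypotheses (he : inward_unit_normal A X e) (hlam : principal_curvatures A X e lam).
Hypotheses (Kn : (K < n)%N) (hconv : forall p, Gamma K.+1 (lam p)).
Let u p := - dot (X p) (e p).
Hypotheses (hsg : sg = 1 \/ sg = -1)
  (hu : forall p, 0 <= sg * ((n - K)%:R * sigma K (lam p) - K.+1%:R * sigma K.+1 (lam p) * u p))
  (hu0 : forall p, sg = -1 -> 0 < u p).

Let Xc := embedding_continuous hX.

Let ee p : dot (e p) (e p) = 1. Proof. by have [] := he p. Qed.

Let sg2 : sg * sg = 1. Proof. by case: hsg => ->; rewrite ?mulr1 // mulrNN mulr1. Qed.

Let GammaE (mu : 'rV[R]_n) p : (forall m, sigma m mu = sigma m (lam p)) -> Gamma K.+1 mu.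
Proof. by move=> E m mK; rewrite E; exact: hconv. Qed.

(** At an extremum of |X| the vector X is normal, and equality holds in the
    maximum principle. *)
Lemma umbilic_at_extremum p :
  (forall q, sg * dot (X q) (X q) <= sg * dot (X p) (X p)) ->
  [/\ X p = - u p *: e p, 0 < u p, dot (X p) (X p) = u p ^+ 2 &
      u p = sigma_quotient K.+1 (lam p)].
Proof.
move=> pmax.
have [E [mu [EE Ee sE crit]]] := critical_frame hM hX he hlam p.
have G := GammaE sE.
(* With eps = 0 the barrier reduces to sg |X|^2 / 2. *)
have [|ZE Hi] := crit sg 0 0 0 0.
  by move=> q; rewrite /barrier !mul0r !addr0 ![sg / 2 * _]mulrAC ler_pM2r ?invr_gt0.
rewrite !mul0r scale0r addr0 in ZE Hi.
have sgX : dot (sg *: X p) (e p) = - sg * u p by rewrite dotZl /u; ring.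
rewrite sgX in ZE Hi.
have XE : X p = - u p *: e p.
  have := congr1 (fun z => sg *: z) ZE; rewrite !scalerA sg2 scale1r => ->.
  by congr (_ *: _); rewrite (_ : sg * _ = - (sg * sg) * u p); [rewrite sg2 mulN1r | ring].
have sg0 : sg != 0 by case: hsg => ->; rewrite ?oppr_eq0 oner_neq0.
have um : forall i, u p * mu 0 i = 1.
  apply: (weighted_umbilic Kn G sg0); first by rewrite !sE; exact: hu.
  by move=> i; have := Hi i; rewrite mul0r addr0.
have us : u p * sigma 1 mu = n%:R.
  have := sum_mu_sigma mu 0; rewrite mul1r => <-; rewrite mulr_sumr.
  under eq_bigr => i _ do rewrite sigma0 mulr1 um.
  by rewrite sumr_const card_ord.
have n0 : 0 < n%:R :> R by rewrite ltr0n; case: (n) Kn.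
have s1 : 0 < sigma 1 mu by apply: G.
have u0 : 0 < u p by rewrite -(pmulr_lgt0 _ s1) us.
split=> //.
  by rewrite XE dotZl dotZr ee mulr1 mulrNN expr2.
rewrite -(sigma_quotient_sigma _ sE) /sigma_quotient /=.
have sK : 0 < sigma K.+1 mu by apply: G; rewrite ltnS leq0n leqnn.
have -> : n%:R - K.+1%:R + 1 = (n - K)%:R :> R.
  by rewrite -natr1 opprD addrA subrK natrB // ltnW.
have E1 : u p * (K.+1%:R * sigma K.+1 mu) = (n - K)%:R * sigma K mu.
  rewrite -(sum_mu_sigma mu K) -(sum_sigma_zero_at mu Kn) mulr_sumr.
  by apply: eq_bigr => i _; rewrite mulrA um mul1r.
by rewrite -E1 mulfK // mulf_neq0 // ?gt_eqF // ltr0n.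
Qed.

(** The maximum point of the barrier is the required point when al is large and
    eps al is small. Positivity of u, up to kap, is where the two signs differ:
    for sg = 1 the second order condition gives it, for sg = - 1 it is an
    assumption. *)
Lemma sphere_approx (r eta : R) (y : 'rV[R]_n.+1) (p0 : M) :
  0 < r -> dot (X p0) (X p0) = r ^+ 2 -> dot y y = 1 ->
  (forall q, sg * dot (X q) (X q) <= sg * r ^+ 2) -> 0 < eta ->
  exists p, dot (X p - r *: y) (X p - r *: y) <= eta.
Proof.
move=> r0 p0r yy Xr eta0.
have [_ cM _ M0] := hM.
have [h Hh] := mean_curvature_bounded hM hX he hlam.
have h0 : 0 < h by apply: lt_le_trans (Hh p0); exact: hconv.
have [pr Hpr] := compact_max cM M0 (dot_continuous Xc (cst_continuous (x := y))).
pose rho := dot (X pr) y.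
pose c := 5 + 2 * r ^+ 2 + 2 * r.
have c0 : 0 < c by rewrite !addr_gt0 // ?mulr_gt0 ?exprn_gt0.
(* dl bounds 1 - t^2, kap and 2 eps; the constant c is that of [barrier_estimate]. *)
have [dl [dl0 dl1 dl4 dle]] : exists dl : R, [/\ 0 < dl, dl <= 1, 4 * dl <= r ^+ 2 & dl * c <= eta].
  exists (Num.min 1 (Num.min (r ^+ 2 / 4) (eta / c))).
  rewrite !lt_min ltr01 !divr_gt0 ?exprn_gt0 //; split=> //.
  - by rewrite ge_min lexx.
  - by rewrite mulrC -ler_pdivlMr // !ge_min lexx orbT.
  - by rewrite -ler_pdivlMr // !ge_min lexx !orbT.
have [al al0 alE] : exists2 al : R, 0 < al & al * dl = K.+1%:R * h.
  exists (K.+1%:R * h / dl); first by rewrite !mulr_gt0 // invr_gt0.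
  by rewrite divfK ?gt_eqF.
have a1 : 0 < al + 1 by rewrite addr_gt0.
have [eps eps0 epsE] : exists2 eps : R, 0 < eps & 2 * eps * (al + 1) = dl.
  exists (dl / (2 * (al + 1))); first by rewrite divr_gt0 // mulr_gt0.
  by field; rewrite gt_eqF.
have eps2 : 2 * eps <= dl.
  by rewrite -epsE ler_peMr ?mulr_ge0 ?(ltW eps0) // lerDr ltW.
have epsal : eps * al <= dl.
  rewrite -epsE mulrDr mulr1 -mulrA mulr_natl mulr2n.
  have := mulr_gt0 eps0 al0; lra.
have [p pmax] := compact_max cM M0 (@barrier_continuous _ _ _ X sg eps al rho y Xc).
exists p.
have [E [mu [EE Ee sE crit]]] := critical_frame hM hX he hlam p.
have G := GammaE sE.
have [ZE Hi] := crit sg eps al rho y pmax.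
pose ex q := expR (al * (dot (X q) y - rho)).
have ex0 q : 0 < ex q by exact: expR_gt0.
have ex1 q : ex q <= 1.
  by rewrite -expR0 ler_expR pmulr_rle0 // subr_le0; exact: Hpr.
rewrite -/(ex p) in ZE Hi.
pose kap := eps * al * ex p; rewrite -/kap in ZE Hi.
have kap0 : 0 < kap by rewrite !mulr_gt0.
have kapd : kap <= dl by rewrite (le_trans _ epsal) // ler_piMr // mulr_ge0 // ltW.
pose t := - dot y (e p).
have zE : dot (sg *: X p + kap *: y) (e p) = - sg * u p - kap * t.
  by rewrite dotDl !dotZl /u /t; ring.
rewrite zE in ZE Hi.
have qE : \sum_i dot y (E i) ^+ 2 = 1 - t ^+ 2.
  by rewrite -yy (parseval EE Ee (ee p) y) /t sqrrN addrC addKr.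
have W := weighted_barrier Kn G _ kap0 al0 qE Hi.
have {W} W : al * (1 - t ^+ 2) <= K.+1%:R * t * sigma 1 mu by apply: W; rewrite !sE; exact: hu.
have s1 : 0 < sigma 1 mu by apply: G.
have t2 : 0 <= 1 - t ^+ 2 by rewrite -qE sumr_ge0 // => i _; exact: sqr_ge0.
have t1 : t <= 1.
  rewrite leNgt; apply/negP => t1; move: t2; rewrite subr_ge0 leNgt => /negP; apply.
  by rewrite exprn_egt1.
have t0 : 0 < t.
  rewrite ltNge; apply/negP => t0.
  have le0 : K.+1%:R * t * sigma 1 mu <= 0.
    by rewrite -mulrA pmulr_rle0 // mulr_le0_ge0 // ltW.
  have E0 : 1 - t ^+ 2 = 0.
    by apply/eqP; rewrite eq_le t2 andbT -(pmulr_rle0 _ al0) (le_trans W).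
  move: W le0; rewrite E0 mulr0 => W le0.
  have : K.+1%:R * t * sigma 1 mu == 0 by rewrite eq_le W le0.
  rewrite !mulf_eq0 (gt_eqF s1) pnatr_eq0 /= orbF => /eqP te.
  by move: E0; rewrite te expr0n subr0 => /eqP; rewrite oner_eq0.
have td : 1 - t ^+ 2 <= dl.
  rewrite -(ler_pM2l al0) alE (le_trans W) //.
  rewrite -mulrA ler_pM2l // (le_trans (y := sigma 1 mu)) ?ler_piMl ?(ltW s1) //.
  by rewrite sE.
have ku : - kap <= u p.
  case: hsg => sgE; last by rewrite (le_trans (y := 0)) ?oppr_le0 ?ltW // hu0.
  (* For sg = 1 the normal component of Z is negative, which bounds u below. *)
  have z0 : - sg * u p - kap * t < 0.
    apply: (weighted_sign Kn G (ka := kap * al) (q := fun i => dot y (E i))).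
      by rewrite mulr_ge0 // ltW.
    by move=> i; have := Hi i; rewrite {2}sgE.
  have kt : kap * t <= kap by rewrite ler_piMr // ltW.
  by rewrite sgE in z0; lra.
have sgXE : sg *: X p = (- sg * u p - kap * t) *: e p - kap *: y by rewrite -ZE addrK.
have eyE : dot (e p) y = - t by rewrite /t opprK dotC.
have xxE : dot (X p) (X p) = u p ^+ 2 + kap ^+ 2 * (1 - t ^+ 2).
  have : dot (sg *: X p) (sg *: X p) = dot (X p) (X p) by rewrite dotZl dotZr mulrA sg2 mul1r.
  rewrite sgXE dotDl !dotDr !dotNl !dotNr !dotZl !dotZr ee yy (dotC y) eyE => <-.
  have -> : u p ^+ 2 = (sg * sg) * u p ^+ 2 by rewrite sg2 mul1r.
  ring.
have xyE : dot (X p) y = u p * t - sg * kap * (1 - t ^+ 2).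
  have -> : dot (X p) y = sg * dot (sg *: X p) y by rewrite dotZl mulrA sg2 mul1r.
  rewrite sgXE dotDl dotNl !dotZl yy eyE.
  have -> : u p * t = (sg * sg) * (u p * t) by rewrite sg2 mul1r.
  ring.
have sgxx : sg * r ^+ 2 - dl <= sg * dot (X p) (X p).
  have := pmax p0; rewrite /barrier -/(ex p) -/(ex p0) p0r => H.
  have := mulr_gt0 eps0 (ex0 p0).
  have : eps * ex p <= eps by rewrite ler_piMr // ltW.
  have : sg / 2 * r ^+ 2 = sg * r ^+ 2 / 2 by ring.
  have : sg / 2 * dot (X p) (X p) = sg * dot (X p) (X p) / 2 by ring.
  move: H; lra.
have sgxx' := Xr p.
have kt2 : 0 <= kap * (1 - t ^+ 2) by rewrite mulr_ge0 // ltW.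
have [xl xu] : r ^+ 2 - dl <= dot (X p) (X p) /\ dot (X p) (X p) <= r ^+ 2 + dl.
  by case: hsg sgxx sgxx' => ->; rewrite ?mul1r ?mulN1r => ? ?; split; lra.
have xyl : u p * t - kap * (1 - t ^+ 2) <= dot (X p) y.
  by rewrite xyE -mulrA lerD2l lerN2; case: hsg => ->; rewrite ?mul1r // mulN1r; lra.
have := barrier_estimate r0 dl0 dl1 dl4 t0 t1 td (ltW kap0) kapd ku xxE xl xu xyl.
rewrite -/c => le; apply: le_trans dle; apply: le_trans le.
rewrite dotDl !dotDr !dotNl !dotNr !dotZl !dotZr yy (dotC y); lra.
Qed.

(** By compactness the distance from r y to the hypersurface is attained, and
    it is arbitrarily small by [sphere_approx]. *)
Lemma sphere_in_range (r : R) (y : 'rV[R]_n.+1) (p0 : M) :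
  0 < r -> dot (X p0) (X p0) = r ^+ 2 -> dot y y = 1 ->
  (forall q, sg * dot (X q) (X q) <= sg * r ^+ 2) -> exists p, X p = r *: y.
Proof.
move=> r0 p0r yy Xr; have [_ cM _ M0] := hM.
pose g q := - dot (X q - r *: y) (X q - r *: y).
have gc : continuous g.
  have hc : continuous (fun q => X q - r *: y).
    by move=> q; apply: cvgB; [exact: Xc | exact: cvg_cst].
  by move=> q; apply: cvgN; exact: (dot_continuous hc hc).
have [p Hp] := compact_max cM M0 gc.
exists p; apply/eqP; rewrite -subr_eq0; apply/eqP/dot_eq0/eqP.
rewrite eq_le dot_ge0 andbT; apply/ler_addgt0Pl => eta eta0.
have [q Hq] := sphere_approx r0 p0r yy Xr eta0.
by rewrite addr0; apply: le_trans Hq; rewrite -lerN2; exact: Hp.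
Qed.

Lemma sphere_normal (r : R) p : 0 < r ->
  (forall q, sg * dot (X q) (X q) <= sg * r ^+ 2) -> dot (X p) (X p) = r ^+ 2 ->
  X p = - r *: e p.
Proof.
move=> r0 Xr pr; have [|XE u0 uE _] := @umbilic_at_extremum p.
  by move=> q; rewrite pr.
rewrite XE; congr (- _ *: _); apply/eqP.
by rewrite -(eqrXn2 (ltn0Sn 1)) ?ltW // -uE pr.
Qed.

(** The radial projection of X q lies on the sphere, hence is X c' for some c',
    and c' is close to q since X is a homeomorphism onto its image. The chord
    from X c' to X q is normal at c', so it is trivial. *)
Lemma sphere_open (r : R) p : 0 < r ->
  (forall q, sg * dot (X q) (X q) <= sg * r ^+ 2) -> dot (X p) (X p) = r ^+ 2 ->
  \forall q \near p, dot (X q) (X q) = r ^+ 2.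
Proof.
move=> r0 Xr pr; have [[[Ach cov _] _ _] _ _ _] := hM; have [_ Yf _ Xo] := hX.
have [c Ac cp] := cov p; have [Uo YC _] := chart_C1 hM hX Ac.
have Up : (coord c @` dom c) (coord c p) by exists p.
have [d d0 Hd] := normal_chord_trivial Uo YC Up (Yf c p Ac cp).
pose NN q := dom c q /\ ball (coord c p) d (coord c q).
have N : nbhs p NN by exact: (near_chart hM Ac cp (nbhsx_ballx _ _ d0)).
have [V Vo VE] : exists2 V, open V & NN^° = X @^-1` V by apply/Xo; exact: open_interior.
have VN q : V (X q) -> NN q.
  by move=> Vq; apply: interior_subset; rewrite VE.
have Vp : V (X p).
  have : NN^° p by exact: N.
  by rewrite VE.
have dc := dot_continuous Xc Xc.
have Vnbhs z : V z -> nbhs z V by move=> Vz; exact: open_nbhs_nbhs.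
pose s q := Num.sqrt (dot (X q) (X q)).
have sp : s p = r by rewrite /s pr sqrtr_sqr gtr0_norm.
have sc : s q @[q --> p] --> s p.
  apply: (continuous_comp (dc p)); exact: sqrt_continuous.
have radial : (r / s q) *: X q @[q --> p] --> X p.
  have -> : X p = (r / s p) *: X p by rewrite sp divff ?gt_eqF // scale1r.
  apply: cvgZ; last exact: Xc.
  by apply: cvgMr; apply: cvgV => //; rewrite sp gt_eqF.
have n1 : \forall q \near p, V (X q) by exact: (Xc (Vnbhs _ Vp)).
have n2 : \forall q \near p, V ((r / s q) *: X q) by exact: (radial _ (Vnbhs _ Vp)).
have n3 : \forall q \near p, 0 < s q.
  by apply: (cvgr_gt _ sc); rewrite sp.
apply: filterS (filterI n1 (filterI n2 n3)) => q [Vq [Vrq sq]].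
have ss : dot (X q) (X q) = s q ^+ 2 by rewrite sqr_sqrtr // dot_ge0.
have [|c' Xc'] := sphere_in_range r0 pr (y := (s q)^-1 *: X q) _ Xr.
  by rewrite dotZl dotZr ss mulrA -expr2 -exprMn mulVf ?gt_eqF // expr1n.
have c'r : dot (X c') (X c') = r ^+ 2.
  by rewrite Xc' !dotZl !dotZr ss; field; rewrite gt_eqF.
have [cq Bq] := VN q Vq.
have [cc' Bc'] : NN c' by apply: VN; rewrite Xc' scalerA.
have E : coord c q = coord c c'.
  apply: (Hd _ _ Bc' Bq (e c') (r - s q) (ee c')).
    by move=> v; exact: (normal_tangent hM hX he).
  have -> : local_param X c (coord c q) = X q := Y_coord X hM Ac cq.
  have -> : local_param X c (coord c c') = X c' := Y_coord X hM Ac cc'.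
  have Xq : X q = (s q / r) *: X c'.
    rewrite Xc' !scalerA (_ : _ * _ = 1) ?scale1r //.
    by field; rewrite !gt_eqF.
  rewrite {1}Xq (sphere_normal r0 Xr c'r) scalerA -scalerBl; congr (_ *: _).
  by field; rewrite gt_eqF.
by rewrite -c'r -(Y_coord X hM Ac cq) E (Y_coord X hM Ac cc').
Qed.

(** The set of points on the sphere is closed, open and nonempty. *)
Lemma sphere_everywhere (r : R) p0 p : 0 < r ->
  (forall q, sg * dot (X q) (X q) <= sg * r ^+ 2) -> dot (X p0) (X p0) = r ^+ 2 ->
  dot (X p) (X p) = r ^+ 2.
Proof.
move=> r0 Xr p0r; have [_ _ conn _] := hM.
have : [set q | dot (X q) (X q) = r ^+ 2] = setT.
  apply: conn; first by exists p0.
    exists [set q | dot (X q) (X q) = r ^+ 2]; last by rewrite setTI.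
    by rewrite openE => q; exact: sphere_open.
  exists [set q | dot (X q) (X q) = r ^+ 2]; last by rewrite setTI.
  apply: (@closed_comp _ _ (fun q => dot (X q) (X q)) [set x | x = r ^+ 2]).
    by move=> q _; exact: (dot_continuous Xc Xc).
  exact: closed_eq.
by move=> E; have : [set q | dot (X q) (X q) = r ^+ 2] p by rewrite E.
Qed.

End Sphere.

Theorem theorem1p9 (R : realType) (n k : nat) (hn : (2 <= n)%N)
  (hk : (1 <= k <= n)%N)
  (M : topologicalType) (A : set (chart R n M))
  (hM : closed_manifold A) (hor : orientable A)
  (X : M -> 'rV[R]_n.+1) (hX : smooth_embedding A X)
  (e : M -> 'rV[R]_n.+1) (he : inward_unit_normal A X e)
  (lam : M -> 'rV[R]_n) (hlam : principal_curvatures A X e lam)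
  (hconv : forall p, Gamma k (lam p))
  (Omega : set 'rV[R]_n) (f : 'rV[R]_n -> R)
  (hf : smooth_symmetric_on Omega f)
  (hOmega : forall p, Omega (lam p))
  (hF : (forall p, sigma_quotient k (lam p) <= f (lam p)) \/
        (forall p, f (lam p) <= sigma_quotient k (lam p)))
  (hsol : forall p, f (lam p) = - dot (X p) (e p)) :
  (forall p, f (lam p) = sigma_quotient k (lam p)) /\
  round_sphere (range X).
Proof.
case: k hk hconv hF => [//|K] Kn hconv hF.
have QE p : sigma_quotient K.+1 (lam p) =
    ((n - K)%:R * sigma K (lam p)) / (K.+1%:R * sigma K.+1 (lam p)).
  by rewrite /sigma_quotient /= -natr1 opprD addrA subrK natrB // ltnW.
have sK p : 0 < K.+1%:R * sigma K.+1 (lam p).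
  by rewrite mulr_gt0 ?ltr0n //; apply: hconv; rewrite ltnS leq0n leqnn.
have sK' p : 0 < sigma K (lam p).
  by case: (K) hconv => [|K'] G; [rewrite sigma0 | apply: G; rewrite ltnS leq0n ltnW].
pose u p := - dot (X p) (e p).
have [sg [hsg hu hu0]] : exists sg : R, [/\ sg = 1 \/ sg = -1,
    forall p, 0 <= sg * ((n - K)%:R * sigma K (lam p) - K.+1%:R * sigma K.+1 (lam p) * u p) &
    forall p, sg = -1 -> 0 < u p].
  case: hF => hF.
    exists (-1); split=> [|p|p _]; first by right.
      rewrite mulN1r opprB subr_ge0 /u -hsol -ler_pdivrMl // mulrC -QE; exact: hF.
    rewrite /u -hsol; apply: lt_le_trans (hF p); rewrite QE divr_gt0 // mulr_gt0 //.
    by rewrite ltr0n subn_gt0.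
  exists 1; split=> [|p|p H]; first by left.
    rewrite mul1r subr_ge0 /u -hsol -ler_pdivlMl // mulrC -QE; exact: hF.
  by have : (1 : R) < 0 by [rewrite H oppr_lt0]; rewrite ltr10.
have [_ cM _ M0] := hM.
have Xc := embedding_continuous hX.
have [p0 Hp0] : exists p, forall q, sg * dot (X q) (X q) <= sg * dot (X p) (X p).
  apply: (compact_max cM M0) => q; apply: cvgMr; exact: (dot_continuous Xc Xc).
have umb := umbilic_at_extremum hM hX he hlam Kn hconv hsg hu.
have [_ r0 p0r _] := umb p0 Hp0.
move: (- dot (X p0) (e p0)) r0 p0r => r r0 p0r.
have Xr q : sg * dot (X q) (X q) <= sg * r ^+ 2 by rewrite -p0r.
have all p := sphere_everywhere hM hX he hlam Kn hconv hsg hu hu0 p r0 Xr p0r.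
split=> [p|].
  by rewrite hsol; have [|_ _ _ ->] := umb p; first by move=> q; rewrite !all.
exists 0, r; split=> //; apply/seteqP; split=> [_ [p _ <-]|z /=].
  by rewrite /= subr0.
rewrite subr0 => zr.
have [|p Xp] := sphere_in_range hM hX he hlam Kn hconv hsg hu hu0 r0 p0r (y := r^-1 *: z) _ Xr.
  by rewrite dotZl dotZr zr mulrA -expr2 -exprMn mulVf ?gt_eqF // expr1n.
by exists p => //; rewrite Xp scalerA divff ?gt_eqF // scale1r.
Qed.
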